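(* Let $n,d\in\mathbb N$, $L,M,D,\varepsilon>0$ and $\delta=o(1/n)$. The class of $(\varepsilon,\delta)$-DP stochastic saddle-point problems with gradient operators within the class $\mathcal M^1_{\mathcal W}(L,M)$, and domain $\mathcal W$ containing a Euclidean ball of diameter $D/2$, satisfies the lower bound (for the weak saddle-point gap) $$\Omega\Big(MD\Big(\frac1{\sqrt n}+\min\Big\{1,\frac{\sqrt d}{\varepsilon n}\Big\}\Big)\Big).$$
   Context: $\mathcal M^1_{\mathcal W}(L,M)$ is the set of operators $G:\mathcal W\to\mathbb R^d$ that are monotone ($\langle G(w_1)-G(w_2),w_1-w_2\rangle\ge0$), $L$-Lipschitz, and $M$-bounded ($\sup_{\mathcal W}\|G\|\le M$), with the Euclidean norm. A stochastic saddle-point instance consists of a compact convex domain $\mathcal W=\mathcal X\times\mathcal Y$, functions $f_\beta:\mathcal X\times\mathcal Y\to\mathbb R$, $\beta\in\mathcal Z$, convex in $x$ and concave in $y$, whose gradient operators $(\nabla_xf_\beta,-\nabla_yf_\beta)$ lie in $\mathcal M^1_{\mathcal W}(L,M)$, and a distribution $\mathcal P$ on $\mathcal Z$; $f=\mathbb E_{\beta\sim\mathcal P}[f_\beta]$. An algorithm $\mathcal A$ maps a data set $\mathbf S\sim\mathcal P^n$ to $\mathcal A(\mathbf S)=(x(\mathbf S),y(\mathbf S))\in\mathcal X\times\mathcal Y$. Its weak saddle-point gap is $\mathrm{WeakGap}_{\mathrm{SP}}(\mathcal A,f)=\mathbb E_{\mathcal A}\sup_{x\in\mathcal X,y\in\mathcal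 Y}\mathbb E_{\mathbf S}[f(x(\mathbf S),y)-f(x,y(\mathbf S))]$, with $\mathbb E_{\mathcal A}$ over the internal randomness. $\mathcal A$ is $(\varepsilon,\delta)$-differentially private if $\mathbb P_{\mathcal A}[\mathcal A(\mathbf S)\in E]\le e^{\varepsilon}\mathbb P_{\mathcal A}[\mathcal A(\mathbf S')\in E]+\delta$ for all events $E$ and all $\mathbf S,\mathbf S'\in\mathcal Z^n$ differing in at most one entry. That the class satisfies a lower bound $\Omega(g)$ means: there is an absolute constant $c>0$ such that every $(\varepsilon,\delta)$-differentially private algorithm has weak saddle-point gap at least $c\,g$ on some instance of the class. *)

(* Defs.v *)
From HB Require Import structures.
From mathcomp Require Import all_boot all_order all_algebra.
From mathcomp Require Import all_classical all_reals all_analysis.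
Import Order.TTheory GRing.Theory Num.Theory.
Import numFieldNormedType.Exports.
Set Implicit Arguments.
Unset Strict Implicit.
Unset Printing Implicit Defensive.
Local Open Scope classical_set_scope.
Local Open Scope ring_scope.

(* The norm that MathComp-Analysis puts on 'rV[R]_d is the sup norm, so the
   Euclidean one is defined here. *)
Section euclidean.
Context {R : realType} {d : nat}.
Implicit Types (u v : 'rV[R]_d) (W : set 'rV[R]_d).

Definition dot u v : R := \sum_(i < d) u 0 i * v 0 i.

Definition enorm u : R := Num.sqrt (dot u u).

Definition contains_eball_of_diameter W (l : R) :=
  exists w0, forall w, enorm (w - w0) <= l / 2 -> W w.

(* Used to keep hard instances at scale D: enlarging the domain of an instance
   enlarges its gap, so a bound proportional to D only has content on domains
   of size of order D. *)
Definition ediameter_le W (l : R) :=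
  forall w1 w2, W w1 -> W w2 -> enorm (w1 - w2) <= l.

Definition M1 W (L M : R) (G : 'rV[R]_d -> 'rV[R]_d) :=
  [/\ forall w1 w2, W w1 -> W w2 -> 0 <= dot (G w1 - G w2) (w1 - w2),
      forall w1 w2, W w1 -> W w2 ->
        enorm (G w1 - G w2) <= L * enorm (w1 - w2) &
      forall w, W w -> enorm (G w) <= M].

(* [g] is the gradient at [x] of [h], a function of which only the restriction
   to [W] matters: h x' = h x + <g, x' - x> + o(x' - x) for x' in W. If W is
   convex with nonempty interior then [g] is unique, also on the boundary. *)
Definition gradient_within W (h : 'rV[R]_d -> R) (x g : 'rV[R]_d) :=
  forall e : R, 0 < e -> \forall x' \near within W (nbhs x),
    `|h x' - h x - dot g (x' - x)| <= e * enorm (x' - x).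

End euclidean.

Section iid.
Context {R : realType} {d : measure_display} {Z : measurableType d}.
Variable P : probability Z R.

Definition cons_tuple n (p : Z * n.-tuple Z) : n.+1.-tuple Z :=
  [tuple of p.1 :: p.2].

Lemma measurable_cons_tuple n : measurable_fun setT (@cons_tuple n).
Proof. by apply: measurable_cons; [exact: measurable_fst|exact: measurable_snd]. Qed.

HB.instance Definition _ n :=
  isMeasurableFun.Build _ _ _ _ (@cons_tuple n) (@measurable_cons_tuple n).

(* The law P^n of a data set of n independent samples from P. *)
Fixpoint iid n : probability (n.-tuple Z) R :=
  match n with
  | 0 => @dirac _ (0.-tuple Z) [tuple] R
  | n.+1 => distribution (P \x iid n)%E (@cons_tuple n)
  end.

End iid.

(* An instance without the distribution of beta, i.e. what an algorithm is
   designed for: it knows X, Y and the functions f_beta, and sees samples. *)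
Record sp_problem (R : realType) (dx dy : nat) := SPProblem {
  domX : set 'rV[R]_dx;
  domY : set 'rV[R]_dy;
  Zdisp : measure_display;
  Zt : measurableType Zdisp;
  loss : Zt -> 'rV[R]_dx -> 'rV[R]_dy -> R }.

Section problem.
Context {R : realType} {dx dy : nat}.
Implicit Type pb : sp_problem R dx dy.

Definition domW pb : set 'rV[R]_(dx + dy) :=
  [set w | domX pb (lsubmx w) /\ domY pb (rsubmx w)].

Definition gradient_operator pb (b : Zt pb)
    (G : 'rV[R]_(dx + dy) -> 'rV[R]_(dx + dy)) :=
  forall x y, domX pb x -> domY pb y -> exists gx gy,
    [/\ gradient_within (domX pb) (fun x' => loss b x' y) x gx,
        gradient_within (domY pb) (fun y' => loss b x y') y gy &
        G (row_mx x y) = row_mx gx (- gy)].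

Definition sp_class (L M D : R) pb :=
  [/\ compact (domX pb) /\ compact (domY pb),
      convex_set (domX pb) /\ convex_set (domY pb),
      contains_eball_of_diameter (domW pb) (D / 2),
      forall b : Zt pb,
        (forall y, domY pb y -> convex_function (domX pb) (fun x => loss b x y))
        /\ (forall x, domX pb x ->
              convex_function (domY pb) (fun y => - loss b x y)) &
      forall b : Zt pb, exists2 G, gradient_operator b G & M1 (domW pb) L M G].

(* Makes the expectation of f_beta(x, y) well defined on the domain. *)
Definition sp_distribution pb (P : probability (Zt pb) R) :=
  forall x y, domX pb x -> domY pb y ->
    P.-integrable setT (fun b => (loss b x y)%:E).

Definition population pb (P : probability (Zt pb) R) x y : R :=
  \int[P]_b loss b x y.

(* The internal randomness of an algorithm is a seed, drawn from [seed_law]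
   independently of the data set. Borel sets are written <<s open >>. *)
Record algorithm n pb := Algorithm {
  seed_disp : measure_display;
  seed : measurableType seed_disp;
  seed_law : probability seed R;
  run : seed -> n.-tuple (Zt pb) -> 'rV[R]_dx * 'rV[R]_dy;
  run_measurable : forall E, <<s open >> E ->
    measurable [set p : seed * n.-tuple (Zt pb) | E (run p.1 p.2)] }.

Definition feasible n pb (A : algorithm n pb) :=
  forall (w : seed A) S, domX pb (run w S).1 /\ domY pb (run w S).2.

Definition neighbours n (T : Type) (S S' : n.-tuple T) :=
  exists i : 'I_n, forall j, j != i -> tnth S j = tnth S' j.

Definition private (eps delta : R) n pb (A : algorithm n pb) :=
  forall S S' : n.-tuple (Zt pb), neighbours S S' ->
  forall E, <<s open >> E ->
    (seed_law A [set w | E (run w S)] <=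
     (expR eps)%:E * seed_law A [set w | E (run w S')] + delta%:E)%E.

Definition weak_gap n pb (A : algorithm n pb) (P : probability (Zt pb) R) :
    \bar R :=
  (\int[seed_law A]_w ereal_sup
     [set (\int[iid P n]_S
            (population P (run w S).1 xy.2 -
             population P xy.1 (run w S).2)%:E)%E
     | xy in domX pb `*` domY pb])%E.

End problem.

(* Main.v *)
From HB Require Import structures.
Require Import Defs.
From mathcomp Require Import all_boot all_order all_algebra.
From mathcomp Require Import all_classical all_reals all_analysis.
From mathcomp Require Import measurable_realfun ring lra.
Import Order.TTheory GRing.Theory Num.Theory.
Import numFieldNormedType.Exports.
Set Implicit Arguments.
Unset Strict Implicit.
Unset Printing Implicit Defensive.
Local Open Scope classical_set_scope.
Local Open Scope ring_scope.

(** The hard instances are bilinear: samples are sign vectors z in {-1, 1}^d, where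
d = dx + dy, the domain is a product of two Euclidean balls of radius r = D / 4, and
f_z (x, y) = kappa (<z_x, x> - <z_y, y>) with kappa = M / sqrt d. The gradient operator
of f_z is the constant kappa z, so it is monotone, Lipschitz for every L, and of norm M.
If the coordinates of z are independent with mean vector q, where |q_j| <= tau, testing
the gap at the point - r q / (tau sqrt d) gives
  gap >= kappa (E <q, a> + r |q|^2 / (tau sqrt d)),
where a is the output of the algorithm averaged over its seed ([weak_gap_ge]). A small
gap thus forces a to be strongly anticorrelated with q.

The link with the samples z_1, ..., z_n is the fingerprinting identity. Let w(q_j) be
(tau^2 - q_j^2) / (1 - q_j^2) and let s_i be the vector with coordinates
w(q_j) (z_ij - q_j). If q is uniform on [-tau, tau]^d then, for every function a of the
data,
  E <a, s_1 + ... + s_n> = 2 E <a, q>.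
In one coordinate this integrates by parts the derivative in q of
(tau^2 - q^2) times the likelihood of the data, which vanishes at both ends. Only
finite sums are used below: the prior is uniform on a grid and the integral of the
derivative becomes a telescoping sum, up to an error that vanishes with the mesh
([sum_deriv_grid], [fingerprint]). On average over the prior |q|^2 is about
d tau^2 / 3, so if <a, s_1 + ... + s_n> has mean at least - r tau sqrt d / 6 for every q,
then some q has gap at least kappa r tau sqrt d / 6 = M D tau / 24
([linear_gap_lower_bound]).

It remains to find the largest tau for which that correlation is under control.
- For any algorithm, Cauchy-Schwarz and the variance of the scores bound it by
  a multiple of r tau^2 sqrt (n d), so tau of order 1 / sqrt n is allowed
  ([sampling_bound]).
- For a private algorithm, each <a, s_i> is compared with the same quantity computed
  on data where z_i was resampled. There the output is independent of z_i, the
  correlation has mean zero and is subgaussian at scale r tau^2. Privacy transfers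
  expectations of bounded functions with a loss of order eps times that scale, plus
  delta times the maximum r tau^2 sqrt d ([private_sample_correlation]). Summing over
  i allows tau of order min (1, sqrt d / (eps n)) as soon as n delta is below an
  absolute constant ([privacy_bound]).
For eps of order 1 or more, the naive factor e^eps would be far too large; there the
subgaussian tail is cut at height eps times the scale instead, which keeps the loss
linear in eps ([expectation_transfer]). The better of the two choices of tau gives the
theorem. *)

(** * Moment generating functions of product sign laws *)

Lemma sum_prod_ffun (R : comPzSemiRingType) (I T : finType) (G : I -> T -> R) :
  \sum_(f : {ffun I -> T}) \prod_i G i (f i) = \prod_i \sum_t G i t.
Proof. by rewrite bigA_distr_bigA. Qed.

Lemma sum_prod_tuple (R : comPzSemiRingType) n (T : finType)
    (G : 'I_n -> T -> R) :
  \sum_(S : n.-tuple T) \prod_i G i (tnth S i) = \prod_i \sum_t G i t.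
Proof.
rewrite -sum_prod_ffun.
rewrite (reindex (fun f : {ffun 'I_n -> T} => [tuple f i | i < n])) /=; last first.
  exists (fun S : n.-tuple T => [ffun i => tnth S i]) => [f _|S _].
    by apply/ffunP => i; rewrite ffunE tnth_mktuple.
  by apply/eq_from_tnth => i; rewrite tnth_mktuple ffunE.
by apply: eq_bigr => f _; apply: eq_bigr => i _; rewrite tnth_mktuple.
Qed.

Section exponential.
Context {R : realType}.
Implicit Types x y : R.

(** From [1 - x <= expR (- x)] one gets [expR x <= (1 - x)^-1]. *)
Lemma expR_le_quadratic x : x <= 2^-1 -> expR x <= 1 + x + 2 * x ^+ 2.
Proof.
move=> x2.
have h : expR x * (1 - x) <= 1.
  rewrite -[leRHS](expRxMexpNx_1 x) ler_wpM2l ?expR_ge0 //.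
  exact: expR_ge1Dx.
have x1 : 0 < 1 - x by lra.
rewrite -(ler_pM2r x1); apply: (le_trans h).
have := sqr_ge0 x; nra.
Qed.

Lemma expR_quarter : expR (4^-1) <= 4 / 3 :> R.
Proof.
have h : expR (4^-1) * (1 - 4^-1) <= 1 :> R.
  rewrite -[leRHS](expRxMexpNx_1 (4^-1)) ler_wpM2l ?expR_ge0 //.
  exact: expR_ge1Dx.
lra.
Qed.

Lemma norm_le_expR x : `|x| <= expR x + expR (- x).
Proof.
have := expR_ge1Dx x; have := expR_ge1Dx (- x).
have := expR_ge0 x; have := expR_ge0 (- x).
by rewrite ler_norml => *; apply/andP; split; lra.
Qed.

(** Turns a bound on moment generating functions into a bound on second moments. *)
Lemma sqr_le_expR x : x ^+ 2 <= 4 * (expR x + expR (- x)).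
Proof.
wlog x0 : x / 0 <= x.
  move=> H; have [/H//|/ltW x0] := leP 0 x.
  by have := H (- x); rewrite oppr_ge0 opprK sqrrN => /(_ x0); lra.
have -> : expR x = expR (x / 2) ^+ 2 by rewrite expr2 -expRD; congr expR; lra.
have h := expR_ge1Dx (x / 2).
have := expR_ge0 (- x).
have : (1 + x / 2) ^+ 2 <= expR (x / 2) ^+ 2 by rewrite ler_sqr ?nnegrE//; lra.
nra.
Qed.

End exponential.

Section sign_vectors.
Context {R : realType}.

Definition sgb (b : bool) : R := if b then 1 else -1.

Lemma sgb_sqr b : sgb b ^+ 2 = 1.
Proof. by case: b; rewrite /sgb ?sqrrN expr1n. Qed.

(** The law of a sign of mean [q]. *)
Definition bern (q : R) (b : bool) : R := (1 + sgb b * q) / 2.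

Lemma bern_ge0 q b : `|q| <= 1 -> 0 <= bern q b.
Proof. by rewrite ler_norml /bern /sgb => /andP[]; case: b; lra. Qed.

Lemma bern_le1 q b : `|q| <= 1 -> bern q b <= 1.
Proof. by rewrite ler_norml /bern /sgb => /andP[]; case: b; lra. Qed.

Lemma sum_bern q : \sum_b bern q b = 1.
Proof. by rewrite big_bool /bern /sgb /=; lra. Qed.

Lemma bern_mean q : \sum_b bern q b * sgb b = q.
Proof. by rewrite big_bool /bern /sgb /=; lra. Qed.

(** A centered sign is subgaussian: in the quadratic upper bound for the exponential
the linear term has mean zero. *)
Lemma bern_mgf q u : `|q| <= 1 -> `|u| <= 4^-1 ->
  \sum_b bern q b * expR (u * (sgb b - q)) <= expR (2 * u ^+ 2).
Proof.
move=> q1 u4; apply: le_trans (expR_ge1Dx _).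
have s2 b : `|sgb b - q| <= 2.
  by move: q1; rewrite !ler_norml /sgb => /andP[]; case: b; lra.
apply: (@le_trans _ _ (\sum_b bern q b * (1 + u * (sgb b - q) +
    2 * (u * (sgb b - q)) ^+ 2))).
  apply: ler_sum => b _; rewrite ler_wpM2l ?bern_ge0// expR_le_quadratic//.
  rewrite (le_trans (ler_norm _))// normrM.
  have := ler_pM (normr_ge0 _) (normr_ge0 _) u4 (s2 b); lra.
rewrite big_bool /bern /sgb /=.
have := sqr_ge0 (u * q); lra.
Qed.

Context {d : nat}.
Implicit Types (q u : 'I_d -> R) (z : {ffun 'I_d -> bool}).

Definition sign_law q z : R := \prod_j bern (q j) (z j).

Lemma sign_law_ge0 q z : (forall j, `|q j| <= 1) -> 0 <= sign_law q z.
Proof. by move=> q1; apply: prodr_ge0 => j _; exact: bern_ge0. Qed.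

Lemma sum_sign_law q : \sum_z sign_law q z = 1.
Proof.
rewrite /sign_law (sum_prod_ffun (fun j b => bern (q j) b)).
by apply: big1 => j _; exact: sum_bern.
Qed.

Lemma sign_law_mean q j : \sum_z sign_law q z * sgb (z j) = q j.
Proof.
pose G i b := bern (q i) b * (if i == j then sgb b else 1).
transitivity (\sum_(z : {ffun 'I_d -> bool}) \prod_i G i (z i)).
  apply: eq_bigr => z _; rewrite /G big_split/=; congr (_ * _).
  by rewrite -big_mkcond/= big_pred1_eq.
rewrite sum_prod_ffun (bigD1 j)//= [X in _ * X]big1 ?mulr1 => [|i ij].
  by rewrite -[RHS]bern_mean; apply: eq_bigr => b _; rewrite /G eqxx.
rewrite -[RHS](sum_bern (q i)); apply: eq_bigr => b _.
by rewrite /G (negbTE ij) mulr1.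
Qed.

Lemma sign_law_mgf q u : (forall j, `|q j| <= 1) -> (forall j, `|u j| <= 4^-1) ->
  \sum_z sign_law q z * expR (\sum_j u j * (sgb (z j) - q j)) <=
  expR (2 * \sum_j u j ^+ 2).
Proof.
move=> q1 u4.
pose G i b := bern (q i) b * expR (u i * (sgb b - q i)).
rewrite [leLHS](_ : _ = \sum_(z : {ffun 'I_d -> bool}) \prod_i G i (z i)); last first.
  by apply: eq_bigr => z _; rewrite expR_sum -big_split.
rewrite sum_prod_ffun mulr_sumr expR_sum.
apply: ler_prod => j _; rewrite bern_mgf// andbT sumr_ge0// => b _.
by rewrite mulr_ge0 ?expR_ge0 ?bern_ge0.
Qed.

Context {n : nat}.
Implicit Types S : n.-tuple {ffun 'I_d -> bool}.

Definition data_law q S : R := \prod_i sign_law q (tnth S i).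

Lemma data_law_ge0 q S : (forall j, `|q j| <= 1) -> 0 <= data_law q S.
Proof. by move=> q1; apply: prodr_ge0 => j _; exact: sign_law_ge0. Qed.

Lemma sum_data_law q : \sum_S data_law q S = 1.
Proof.
rewrite /data_law (sum_prod_tuple (fun=> sign_law q)).
by apply: big1 => i _; exact: sum_sign_law.
Qed.

Lemma data_law_mgf q j (t : R) : (forall j, `|q j| <= 1) -> `|t| <= 4^-1 ->
  \sum_S data_law q S * expR (t * \sum_i (sgb (tnth S i j) - q j)) <=
  expR (2 * (n%:R * t ^+ 2)).
Proof.
move=> q1 t4.
pose G (i : 'I_n) z := sign_law q z * expR (t * (sgb (z j) - q j)).
rewrite [leLHS](_ : _ = \sum_(S : n.-tuple {ffun 'I_d -> bool}) \prod_i G i (tnth S i)); last first.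
  by apply: eq_bigr => S _; rewrite mulr_sumr expR_sum -big_split.
rewrite sum_prod_tuple.
rewrite (_ : 2 * _ = n%:R * (2 * t ^+ 2)); last by ring.
rewrite expRM_natl -[n in leRHS]card_ord -prodr_const.
apply: ler_prod => i _; apply/andP; split.
  by apply: sumr_ge0 => z _; rewrite mulr_ge0 ?expR_ge0 ?sign_law_ge0.
have := @sign_law_mgf q (fun k => if k == j then t else 0) q1.
have sE (F : 'I_d -> R) :
    \sum_k (if k == j then t else 0) * F k = t * F j.
  rewrite (bigD1 j)//= eqxx big1 ?addr0// => k /negbTE ->.
  by rewrite mul0r.
rewrite [X in expR (2 * X)](_ : _ = t ^+ 2); last first.
  rewrite (bigD1 j)//= eqxx big1 ?addr0// => k /negbTE ->.
  by rewrite expr0n.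
under eq_bigr do rewrite sE.
by apply => k; case: eqP => // _; rewrite normr0; lra.
Qed.

(** The second moment is read off the moment generating function at the two rates
[(4 * sqrt n)^-1] and [- (4 * sqrt n)^-1], where it is at most [4 / 3]. *)
Lemma data_law_sqr q j : (0 < n)%N -> (forall j, `|q j| <= 1) ->
  \sum_S data_law q S * (\sum_i (sgb (tnth S i j) - q j)) ^+ 2 <= 256 * n%:R.
Proof.
move=> n0 q1; pose s : R := Num.sqrt n%:R.
have s1 : 1 <= s by rewrite -[leLHS]sqrtr1 ler_sqrt// ler1n.
have s2 : s ^+ 2 = n%:R by rewrite sqr_sqrtr.
have t4 : `|(4 * s)^-1| <= 4^-1.
  by rewrite ger0_norm ?invr_ge0 ?lef_pV2 ?posrE; lra.
have e4 : 2 * (n%:R * (4 * s)^-1 ^+ 2) <= 4^-1.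
  have nz : n%:R != 0 :> R by rewrite pnatr_eq0 -lt0n.
  have -> : n%:R * (4 * s)^-1 ^+ 2 = 16^-1 by rewrite exprVn exprMn s2; field.
  by lra.
have H (t : R) : `|t| <= 4^-1 -> t ^+ 2 = (4 * s)^-1 ^+ 2 ->
   \sum_S data_law q S * expR (t * \sum_i (sgb (tnth S i j) - q j)) <= 4 / 3.
  move=> tle te; apply: (le_trans (data_law_mgf j q1 tle)).
  by apply: le_trans expR_quarter; rewrite ler_expR te.
have H1 := H _ t4 erefl.
have H2 := H (- (4 * s)^-1); rewrite normrN sqrrN in H2.
have {}H2 := H2 t4 erefl.
apply: (@le_trans _ _ (64 * n%:R *
  (\sum_S data_law q S * expR ((4 * s)^-1 * \sum_i (sgb (tnth S i j) - q j)) +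
   \sum_S data_law q S * expR (- (4 * s)^-1 * \sum_i (sgb (tnth S i j) - q j))))); last first.
  rewrite -[leRHS]mulr1 mulrAC -mulrA mulrC; have : 0 <= n%:R :> R by []. nra.
rewrite -big_split mulr_sumr; apply: ler_sum => S _ /=.
rewrite -mulrDr [leRHS]mulrCA ler_wpM2l ?data_law_ge0//.
set X := \sum_i _; have := sqr_le_expR ((4 * s)^-1 * X).
rewrite exprMn exprVn exprMn s2 mulNr.
have n0' : 0 < 16 * n%:R :> R by rewrite mulr_gt0// ltr0n.
move=> h; have : 16 * n%:R * ((4 ^+ 2 * n%:R)^-1 * X ^+ 2) <=
    16 * n%:R * (4 * (expR ((4 * s)^-1 * X) + expR (- ((4 * s)^-1 * X)))).
  by rewrite ler_pM2l.
rewrite (_ : 4 ^+ 2 = 16 :> R) ?mulrA ?divff ?mul1r ?gt_eqF//; last by rewrite -natrX.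
lra.
Qed.

End sign_vectors.

(** * Summing a derivative over a grid *)

Lemma horner_bounded (R : realType) (p : {poly R}) :
  exists2 C, 0 <= C & forall x, `|x| <= 2 -> `|p.[x]| <= C.
Proof.
elim/poly_ind: p => [|p c [C C0 IH]].
  by exists 0 => // x _; rewrite horner0 normr0.
exists (C * 2 + `|c|) => [|x x2]; first by rewrite addr_ge0 ?mulr_ge0.
rewrite hornerMXaddC (le_trans (ler_normD _ _))// lerD2r normrM.
by rewrite ler_pM// IH.
Qed.

(** Controls the error made when the increment of a polynomial over one step of a grid
is replaced by its derivative. *)
Lemma horner_taylor1 (R : realType) (p : {poly R}) :
  exists2 C, 0 <= C & forall x h, `|x| <= 2 -> `|h| <= 2 ->
    `|p.[x + h] - p.[x] - h * p^`().[x]| <= C * h ^+ 2.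
Proof.
elim/poly_ind: p => [|p c [C C0 IH]].
  by exists 0 => // x h _ _; rewrite deriv0 !horner0 mulr0 !subr0 normr0 mul0r.
have [E E0 HE] := horner_bounded p^`().
exists (C * 4 + E) => [|x h x2 h2]; first by rewrite addr_ge0 ?mulr_ge0.
rewrite derivMXaddC !hornerMXaddC hornerD hornerMX.
have -> : p.[x + h] * (x + h) + c - (p.[x] * x + c) -
    h * (p.[x] + p^`().[x] * x) =
  (p.[x + h] - p.[x] - h * p^`().[x]) * (x + h) + p^`().[x] * h ^+ 2.
  by ring.
rewrite (le_trans (ler_normD _ _))// [leRHS]mulrDl lerD//.
  rewrite normrM mulrAC ler_pM ?IH//.
  by rewrite (le_trans (ler_normD _ _))//; lra.
by rewrite normrM [`|h ^+ 2|]ger0_norm ?sqr_ge0// ler_wpM2r ?sqr_ge0// HE.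
Qed.

Section grid.
Context {R : realType}.
Variable tau : R.

Definition grid K (k : nat) : R := tau * (2 * k%:R / K%:R - 1).

Lemma grid_norm K k : 0 <= tau -> (k <= K)%N -> `|grid K k| <= tau.
Proof.
move=> tau0 kK; rewrite /grid normrM ger0_norm// -[leRHS]mulr1 ler_wpM2l//.
case: K kK => [|K] kK; first by rewrite invr0 mulr0 sub0r normrN1.
have h : 0 <= (k%:R / K.+1%:R : R) <= 1.
  by rewrite divr_ge0//= ler_pdivrMr ?ltr0n// mul1r ler_nat.
rewrite ler_norml -mulrA; move: (_ / _) h => x /andP[x0 x1].
by apply/andP; split; lra.
Qed.

Lemma grid_sqr_sum K : (0 < K)%N ->
  K%:R * (tau ^+ 2 / 3) <= \sum_(k < K) grid K k ^+ 2.
Proof.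
move=> K0; have Kn : K%:R != 0 :> R by rewrite pnatr_eq0 -lt0n.
have H (x : R) m : \sum_(k < m) (2 * k%:R - x) ^+ 2 =
    (4 * m%:R ^+ 3 - 6 * m%:R ^+ 2 + 2 * m%:R) / 3
    - 2 * x * (m%:R ^+ 2 - m%:R) + m%:R * x ^+ 2.
  elim: m => [|m IH]; first by rewrite big_ord0; lra.
  by rewrite big_ord_recr/= IH -natr1; field.
have -> : \sum_(k < K) grid K k ^+ 2 =
    (tau / K%:R) ^+ 2 * \sum_(k < K) (2 * k%:R - K%:R) ^+ 2.
  by rewrite mulr_sumr; apply: eq_bigr => k _; rewrite /grid; field.
rewrite H.
have -> : (tau / K%:R) ^+ 2 * ((4 * K%:R ^+ 3 - 6 * K%:R ^+ 2 + 2 * K%:R) / 3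
    - 2 * K%:R * (K%:R ^+ 2 - K%:R) + K%:R * K%:R ^+ 2) =
  K%:R * (tau ^+ 2 / 3) + 2 / 3 * tau ^+ 2 / K%:R by field.
by rewrite lerDl divr_ge0// mulr_ge0 ?sqr_ge0//; lra.
Qed.

(** Up to a second-order error per step, the sum times the mesh telescopes to
[p.[tau] - p.[- tau] = 0]. The sum is therefore bounded uniformly in the number of
points, so its average over the grid tends to zero. *)
Lemma sum_deriv_grid (p : {poly R}) : 0 < tau -> tau <= 1 ->
    p.[tau] = p.[- tau] ->
  exists2 B, 0 <= B & forall K, (0 < K)%N -> `|\sum_(k < K) p^`().[grid K k]| <= B.
Proof.
move=> tau0 tau1 pE; have [C C0 HC] := horner_taylor1 p.
exists (C * (2 * tau)) => [|K K0]; first by rewrite !mulr_ge0// ltW.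
have KR : 0 < K%:R :> R by rewrite ltr0n.
pose h := 2 * tau / K%:R.
have h0 : 0 < h by rewrite /h divr_gt0// mulr_gt0.
have hK : h * K%:R = 2 * tau by rewrite /h mulfVK// gt_eqF.
have gS k : grid K k.+1 = grid K k + h.
  by rewrite /grid /h -natr1; field; rewrite gt_eqF.
have tele : \sum_(k < K) (p.[grid K k.+1] - p.[grid K k]) = 0.
  rewrite -(big_mkord xpredT (fun k => p.[grid K k.+1] - p.[grid K k])).
  rewrite telescope_sumr// /grid !mulr0 mul0r sub0r mulrN1 mulfK ?gt_eqF//.
  by rewrite (_ : 2 - 1 = 1) ?mulr1 ?pE ?subrr//; lra.
rewrite -(ler_pM2l h0) -[h in leLHS]gtr0_norm// -normrM.
have -> : h * \sum_(k < K) p^`().[grid K k] =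
    - \sum_(k < K) (p.[grid K k + h] - p.[grid K k] - h * p^`().[grid K k]).
  rewrite sumrB; under [X in - (X - _)]eq_bigr do rewrite -gS.
  by rewrite tele sub0r opprK mulr_sumr.
rewrite normrN (le_trans (ler_norm_sum _ _ _))//.
apply: (@le_trans _ _ (\sum_(k < K) C * h ^+ 2)).
  apply: ler_sum => k _; apply: HC.
    by rewrite (le_trans (grid_norm (ltW tau0) (ltnW (ltn_ord k))))//; lra.
  rewrite gtr0_norm// /h ler_pdivrMr//.
  have : 1 <= K%:R :> R by rewrite ler1n.
  nra.
rewrite sumr_const card_ord -[leLHS]mulr_natr.
by rewrite (_ : h * (C * (2 * tau)) = C * h ^+ 2 * K%:R)// -hK; ring.
Qed.

(** Its zeros at [tau] and [- tau] remove the boundary terms of an integration by parts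
over [[- tau, tau]]; the denominator is the variance of a sign of mean [q], which appears
in the derivative of the log-likelihood. *)
Definition score_weight (q : R) : R := (tau ^+ 2 - q ^+ 2) / (1 - q ^+ 2).

Lemma score_weight_bounds q : 0 <= tau -> tau <= 2^-1 -> `|q| <= tau ->
  0 <= score_weight q <= tau ^+ 2.
Proof.
move=> tau0 tau1 qt.
have q2 : q ^+ 2 <= tau ^+ 2 by rewrite -real_normK ?num_real// ler_sqr ?nnegrE.
have t2 : tau ^+ 2 <= 4^-1.
  by have := ler_pM tau0 tau0 tau1 tau1; rewrite -expr2; lra.
have := sqr_ge0 q.
move=> q0; rewrite /score_weight divr_ge0 ?ler_pdivrMr//=; [|lra..].
nra.
Qed.

Section fingerprint.
Variable n : nat.


Let lik (c : 'I_n -> bool) q : R := \prod_i bern q (c i).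

(** The derivative at [q] of [(tau ^+ 2 - q ^+ 2)] times the likelihood of the column [c],
divided by this likelihood. *)
Definition stein_score (c : 'I_n -> bool) (q : R) : R :=
  score_weight q * (\sum_i (sgb (c i) - q)) - 2 * q.

Let sgnpoly (b : bool) : {poly R} := 2^-1 *: (1%:P + sgb b *: 'X).

Let sgnpolyE b q : (sgnpoly b).[q] = bern q b.
Proof. by rewrite /sgnpoly /bern !hornerE mulrC. Qed.

Let likpoly_deriv q (s : seq 'I_n) (c : 'I_n -> bool) :
  (1 - q ^+ 2) * (\prod_(i <- s) sgnpoly (c i))^`().[q] =
  (\prod_(i <- s) bern q (c i)) * \sum_(i <- s) (sgb (c i) - q).
Proof.
elim: s => [|i s IH]; first by rewrite !big_nil -polyC1 derivC horner0 !mulr0.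
rewrite !big_cons derivM hornerD !hornerM mulrDr.
rewrite [_ * (_ * _^`().[q])]mulrCA IH sgnpolyE mulrDr.
rewrite (_ : (\prod_(j <- s) sgnpoly (c j)).[q] = \prod_(j <- s) bern q (c j)); last first.
  by rewrite horner_prod; apply: eq_bigr => j _; rewrite sgnpolyE.
rewrite (_ : (sgnpoly (c i))^`().[q] = sgb (c i) / 2); last first.
  by rewrite /sgnpoly derivZ derivD derivC derivZ derivX add0r !hornerZ -polyC1 hornerC mulr1 mulrC.
set P := \prod_(j <- s) _; rewrite /bern; have := sgb_sqr (R := R) (c i).
set s0 := sgb (c i) => s1; set X := \sum_(j <- s) _.
apply/eqP; rewrite -subr_eq0; apply/eqP.
transitivity (P * q * 2^-1 * (1 - s0 ^+ 2)); first by field.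
by rewrite s1 subrr mulr0.
Qed.

(** Each summand is the derivative of a polynomial vanishing at [tau] and [- tau]. *)
Lemma stein_score_grid_sum : 0 < tau -> tau <= 2^-1 ->
  exists2 B, 0 <= B & forall K (c : {ffun 'I_n -> bool}), (0 < K)%N ->
    `|\sum_(k < K) lik c (grid K k) * stein_score c (grid K k)| <= B.
Proof.
move=> tau0 tau1.
pose F (c : {ffun 'I_n -> bool}) : {poly R} :=
  ((tau ^+ 2)%:P - 'X^2) * \prod_i sgnpoly (c i).
have FE c : (F c).[tau] = (F c).[- tau].
  by rewrite /F !hornerM !hornerE sqrrN subrr !mul0r.
have tle1 : tau <= 1 by lra.
have /choice[B HB] c : exists B, 0 <= B /\ forall K, (0 < K)%N ->
    `|\sum_(k < K) (F c)^`().[grid K k]| <= B.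
  by have [B B0 HB] := sum_deriv_grid tau0 tle1 (FE c); exists B.
exists (\sum_c B c) => [|K c K0]; first by apply: sumr_ge0 => c _; case: (HB c).
apply: (@le_trans _ _ (B c)); last first.
  rewrite (bigD1 c)//= lerDl; apply: sumr_ge0 => c' _.
  by case: (HB c').
case: (HB c) => _ /(_ K K0); congr (`|_| <= _); apply: eq_bigr => k _.
set q := grid K k.
have qt : `|q| <= tau by rewrite grid_norm// ?ltW// ltnW.
have q2 : 0 < 1 - q ^+ 2.
  have : q ^+ 2 <= tau ^+ 2.
    by rewrite -real_normK ?num_real// ler_sqr ?nnegrE// ltW.
  nra.
rewrite /F derivM hornerD !hornerM derivB derivC derivXn !hornerE.
rewrite (_ : (\prod_i sgnpoly (c i)).[q] = lik c q); last first.
  by rewrite horner_prod; apply: eq_bigr => j _; rewrite sgnpolyE.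
have D : (\prod_i sgnpoly (c i))^`().[q] =
    lik c q * (\sum_i (sgb (c i) - q)) / (1 - q ^+ 2).
  by rewrite /lik -likpoly_deriv mulrAC divff ?mul1r// gt_eqF.
rewrite D /stein_score /score_weight; field; rewrite gt_eqF//.
Qed.

End fingerprint.
End grid.

(** * The fingerprinting identity under a grid prior *)

Lemma exists_ge_average (R : realDomainType) (T : finType) (X : T -> R) (m : R) :
  (0 < #|T|)%N -> #|T|%:R * m <= \sum_t X t -> exists t, m <= X t.
Proof.
move=> T0 le_sum; apply: contrapT => H.
have /card_gt0P[t0 _] : (0 < #|T|)%N by [].
suff : \sum_t X t < \sum_(t : T) m.
  by rewrite sumr_const -mulr_natl ltNge le_sum.
apply: ltr_sum => [|t _].
  by apply/hasP; exists t0 => //; rewrite mem_index_enum.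
by rewrite ltNge; apply/negP => mX; apply: H; exists t.
Qed.

Section prior.
Context {R : realType}.
Variables (tau : R) (d n : nat).
Implicit Type a : n.-tuple {ffun 'I_d -> bool} -> 'I_d -> R.

(** The mean vector indexed by the point [v] of the [d]-dimensional grid. *)
Definition prior_mean K (v : {ffun 'I_d -> 'I_K}) (j : 'I_d) : R := grid tau K (v j).

Lemma sum_ffun_coord K (j : 'I_d) (H : 'I_K -> R) :
  \sum_(v : {ffun 'I_d -> 'I_K}) H (v j) = K%:R ^+ d.-1 * \sum_k H k.
Proof.
pose G i k := if i == j then H k else 1.
transitivity (\sum_(v : {ffun 'I_d -> 'I_K}) \prod_i G i (v i)).
  by apply: eq_bigr => v _; rewrite /G -big_mkcond/= big_pred1_eq.
rewrite sum_prod_ffun (bigD1 j)//= mulrC /G eqxx; congr (_ * _).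
under eq_bigr => i /negbTE ij do rewrite ij sumr_const card_ord.
by rewrite prodr_const cardC1 card_ord.
Qed.

Lemma sum_prior_mean_sqr K : (0 < K)%N ->
  K%:R ^+ d * (d%:R * (tau ^+ 2 / 3)) <=
  \sum_(v : {ffun 'I_d -> 'I_K}) \sum_j prior_mean v j ^+ 2.
Proof.
move=> K0; rewrite exchange_big/=.
rewrite mulrCA mulr_natl -[X in _ *+ X]card_ord -sumr_const.
apply: ler_sum => j _.
rewrite (sum_ffun_coord j (fun k => grid tau K k ^+ 2)).
have -> : K%:R ^+ d = K%:R ^+ d.-1 * K%:R :> R.
  by rewrite -exprSr prednK// (leq_ltn_trans _ (ltn_ord j)).
by rewrite -mulrA ler_wpM2l ?exprn_ge0// grid_sqr_sum.
Qed.

Lemma prior_mean_norm K (v : {ffun 'I_d -> 'I_K}) j : 0 <= tau -> `|prior_mean v j| <= tau.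
Proof. by move=> tau0; rewrite grid_norm// ltnW. Qed.

(** The law of the data is a product over coordinates, so the sum over the prior
factors; the factors of the other coordinates are at most [K]. *)
Lemma sum_stein_score_coord K (S : n.-tuple {ffun 'I_d -> bool}) (j : 'I_d) (B : R) :
  0 <= tau -> tau <= 1 ->
  `|\sum_(k < K) (\prod_i bern (grid tau K k) (tnth S i j)) *
      stein_score tau (fun i => tnth S i j) (grid tau K k)| <= B ->
  `|\sum_(v : {ffun 'I_d -> 'I_K}) data_law (prior_mean v) S *
      stein_score tau (fun i => tnth S i j) (prior_mean v j)| <= B * K%:R ^+ d.-1.
Proof.
move=> tau0 tau1 HB.
pose G l (k : 'I_K) := (\prod_i bern (grid tau K k) (tnth S i l)) *
  (if l == j then stein_score tau (fun i => tnth S i l) (grid tau K k) else 1).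
rewrite (_ : \sum_v _ = \prod_l \sum_k G l k); last first.
  rewrite -sum_prod_ffun; apply: eq_bigr => v _; rewrite /G big_split/=.
  rewrite /data_law /sign_law exchange_big/=; congr (_ * _).
  by rewrite -big_mkcond/= big_pred1_eq.
rewrite normr_prod (bigD1 j)//= ler_pM ?prodr_ge0//.
  by rewrite /G eqxx.
rewrite -[d in d.-1]card_ord -(cardC1 j) -prodr_const.
apply: ler_prod => l lj; rewrite normr_ge0/=.
rewrite (le_trans (ler_norm_sum _ _ _))//.
rewrite -[K in K%:R]card_ord -sumr_const; apply: ler_sum => k _.
have g1 : `|grid tau K k| <= 1 by rewrite (le_trans (grid_norm _ (ltnW (ltn_ord k)))).
rewrite /G (negbTE lj) mulr1 ger0_norm; last first.
  by apply: prodr_ge0 => i _; exact: bern_ge0.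
by apply: prodr_ile1 => i _; rewrite bern_ge0// bern_le1.
Qed.

(** The fingerprinting identity in approximate form: averaged over the grid prior, the
correlation of any bounded function of the data with the scores of all samples equals
twice its correlation with the unknown mean, up to an arbitrarily small error. *)
Lemma fingerprint (r e : R) : 0 < tau -> tau <= 2^-1 -> 0 <= r -> 0 < e ->
  exists2 K, (0 < K)%N & forall a, (forall S j, `|a S j| <= r) ->
    `|\sum_(v : {ffun 'I_d -> 'I_K}) \sum_S data_law (prior_mean v) S *
       \sum_j a S j * stein_score tau (fun i => tnth S i j) (prior_mean v j)| <= e * K%:R ^+ d.
Proof.
move=> tau0 tau2 r0 e0; have [B B0 HB] := stein_score_grid_sum n tau0 tau2.
pose C := (#|{: n.-tuple {ffun 'I_d -> bool}}|%:R * (d%:R * (r * B))).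
have C0 : 0 <= C by rewrite !mulr_ge0.
pose K := (Num.bound (C / e)).+1.
have CK : C <= e * K%:R.
  rewrite -ler_pdivrMl// mulrC ltW// (lt_le_trans (archi_boundP _))//.
    by rewrite divr_ge0// ltW.
  by rewrite ler_nat.
exists K => // a ar.
have -> : \sum_(v : {ffun 'I_d -> 'I_K}) \sum_S data_law (prior_mean v) S *
       \sum_j a S j * stein_score tau (fun i => tnth S i j) (prior_mean v j) =
   \sum_S \sum_j a S j * \sum_(v : {ffun 'I_d -> 'I_K}) data_law (prior_mean v) S *
      stein_score tau (fun i => tnth S i j) (prior_mean v j).
  rewrite exchange_big; apply: eq_bigr => S _ /=.
  under eq_bigr do rewrite mulr_sumr.
  rewrite exchange_big; apply: eq_bigr => j _ /=.
  by rewrite mulr_sumr; apply: eq_bigr => v _; rewrite mulrCA.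
case: (posnP d) => [d0|d0].
  rewrite big1 ?normr0 ?mulr_ge0 ?exprn_ge0 ?ltW// => S _.
  by apply: big1 => j _; have := ltn_ord j; rewrite [X in (_ < X)%N]d0.
apply: (@le_trans _ _ (C * K%:R ^+ d.-1)); last first.
  by rewrite -[d in leRHS]prednK// exprS mulrA ler_wpM2r ?exprn_ge0.
rewrite (le_trans (ler_norm_sum _ _ _))// /C -mulrA mulr_natl -sumr_const.
apply: ler_sum => S _.
rewrite (le_trans (ler_norm_sum _ _ _))// -mulrA mulr_natl.
rewrite -[X in _ *+ X]card_ord -sumr_const.
apply: ler_sum => j _; rewrite normrM -mulrA ler_pM//.
apply: sum_stein_score_coord => //; [exact: ltW|lra|].
have := HB K [ffun i => tnth S i j] isT; congr (`|_| <= _).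
apply: eq_bigr => k _; congr (_ * _); last congr (_ * _ - _);
  by apply: eq_bigr => i _; rewrite ffunE.
Qed.

Definition score (q : 'I_d -> R) (z : {ffun 'I_d -> bool}) (j : 'I_d) : R :=
  score_weight tau (q j) * (sgb (z j) - q j).

(** If the output is not too negatively correlated with the scores, the fingerprinting
identity says the same of its correlation with [q]. On average over the prior this
cannot compensate the term in [q j ^+ 2], which contributes at least a third of
[r * tau * sqrt d]; hence some [q] is as good as the average. *)
Lemma linear_gap_lower_bound (r : R) a : (0 < d)%N -> 0 < r ->
  0 < tau -> tau <= 2^-1 -> (forall S j, `|a S j| <= r) ->
  (forall q : 'I_d -> R, (forall j, `|q j| <= tau) ->
    - (r * tau * Num.sqrt d%:R / 6) <=
    \sum_S data_law q S * \sum_i \sum_j a S j * score q (tnth S i) j) ->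
  exists2 q : 'I_d -> R, (forall j, `|q j| <= tau) &
    r * tau * Num.sqrt d%:R / 6 <=
    \sum_S data_law q S * (\sum_j a S j * q j) +
    r / (tau * Num.sqrt d%:R) * \sum_j q j ^+ 2.
Proof.
move=> d0 r0 tau0 tau2 ar U.
have sd0 : 0 < Num.sqrt d%:R :> R by rewrite sqrtr_gt0 ltr0n.
set b := r * tau * Num.sqrt d%:R in U *.
have b0 : 0 < b by rewrite !mulr_gt0.
have b60 : 0 < b / 6 by rewrite divr_gt0.
have [K K0 HK] := fingerprint tau0 tau2 (ltW r0) b60.
have {HK} := HK a ar; rewrite ler_norml => /andP[_ HK].
pose X (v : {ffun 'I_d -> 'I_K}) := \sum_S data_law (prior_mean v) S * (\sum_j a S j * prior_mean v j) +
    r / (tau * Num.sqrt d%:R) * \sum_j prior_mean v j ^+ 2.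
have cardK : #|{ffun 'I_d -> 'I_K}|%:R = K%:R ^+ d :> R.
  by rewrite card_ffun !card_ord natrX.
suff [v Xv] : exists v, b / 6 <= X v.
  by exists (prior_mean v) => // j; rewrite prior_mean_norm// ltW.
apply: exists_ge_average.
  by rewrite card_ffun !card_ord expn_gt0 K0.
rewrite cardK /X big_split/= -mulr_sumr.
have KD0 : 0 <= K%:R ^+ d :> R by rewrite exprn_ge0.
have P2 : K%:R ^+ d * (b / 3) <= r / (tau * Num.sqrt d%:R) *
    \sum_(v : {ffun 'I_d -> 'I_K}) \sum_j prior_mean v j ^+ 2.
  have c0 : 0 <= r / (tau * Num.sqrt d%:R) by rewrite divr_ge0 ?mulr_ge0 ?ltW.
  apply: le_trans (ler_wpM2l c0 (sum_prior_mean_sqr K0)).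
  rewrite [leRHS]mulrCA ler_wpM2l// /b.
  have : d%:R = Num.sqrt d%:R ^+ 2 :> R by rewrite sqr_sqrtr.
  move: (Num.sqrt _) sd0 => s s0 ->.
  by rewrite le_eqVlt; apply/orP; left; apply/eqP; field; rewrite !gt_eqF.
have P1 : - (K%:R ^+ d * (b / 6)) <=
    \sum_(v : {ffun 'I_d -> 'I_K}) \sum_S data_law (prior_mean v) S *
       \sum_i \sum_j a S j * score (prior_mean v) (tnth S i) j.
  rewrite -mulrN -cardK mulr_natl -sumr_const; apply: ler_sum => v _.
  by apply: U => j; rewrite prior_mean_norm// ltW.
have E : \sum_(v : {ffun 'I_d -> 'I_K}) \sum_S data_law (prior_mean v) S *
       \sum_j a S j * stein_score tau (fun i => tnth S i j) (prior_mean v j) =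
  \sum_(v : {ffun 'I_d -> 'I_K}) \sum_S data_law (prior_mean v) S *
       \sum_i \sum_j a S j * score (prior_mean v) (tnth S i) j -
  2 * \sum_(v : {ffun 'I_d -> 'I_K}) \sum_S data_law (prior_mean v) S * (\sum_j a S j * prior_mean v j).
  rewrite [2 * _]mulr_sumr -sumrB; apply: eq_bigr => v _.
  rewrite [2 * _]mulr_sumr -sumrB; apply: eq_bigr => S _.
  rewrite [2 * _]mulrCA -mulrBr [2 * _]mulr_sumr; congr (_ * _).
  rewrite exchange_big/= -sumrB; apply: eq_bigr => j _.
  by rewrite -mulr_sumr /score -mulr_sumr /stein_score; ring.
by move: HK; rewrite E; lra.
Qed.

End prior.

(** * Correlation of an output with fresh and used samples *)

Section scores.
Context {R : realType}.
Variables (tau r : R) (d n : nat).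
Hypotheses (tau0 : 0 < tau) (tau2 : tau <= 2^-1) (r0 : 0 < r).
Variable q : 'I_d -> R.
Hypothesis qt : forall j, `|q j| <= tau.
Implicit Types (A : 'I_d -> R) (z : {ffun 'I_d -> bool}).

Let q1 j : `|q j| <= 1.
Proof. by apply: le_trans (qt j) (le_trans tau2 _); rewrite invf_le1 ?ler1n. Qed.

Let omb j : 0 <= score_weight tau (q j) <= tau ^+ 2.
Proof. by apply: score_weight_bounds => //; exact: ltW. Qed.

Lemma score_norm z j : `|score tau q z j| <= 2 * tau ^+ 2.
Proof.
have /andP[w0 w1] := omb j.
rewrite /score normrM ger0_norm// mulrC ler_pM//.
by have := q1 j; rewrite !ler_norml /sgb => /andP[]; case: (z j) => *; apply/andP; split; lra.
Qed.

(** For [l > 0], the product of [a S j] with the [j]-th coordinate of the sum of the scores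
is at least minus [l / 2] times the square of the first, minus [(2 * l)^-1] times the square
of the second. The mean squares of these sums are of order [n * tau ^+ 4] because the
samples are independent. *)
Lemma sampling_bound (a : n.-tuple {ffun 'I_d -> bool} -> 'I_d -> R) :
  (0 < n)%N -> (0 < d)%N -> (forall S, \sum_j a S j ^+ 2 <= 2 * r ^+ 2) ->
  tau * Num.sqrt n%:R <= 144^-1 ->
  - (r * tau * Num.sqrt d%:R / 6) <=
    \sum_S data_law q S * \sum_i \sum_j a S j * score tau q (tnth S i) j.
Proof.
move=> n0 d0 a2.
have : d%:R = Num.sqrt d%:R ^+ 2 :> R by rewrite sqr_sqrtr.
have : 0 < Num.sqrt d%:R :> R by rewrite sqrtr_gt0 ltr0n.
have : n%:R = Num.sqrt n%:R ^+ 2 :> R by rewrite sqr_sqrtr.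
have : 0 < Num.sqrt n%:R :> R by rewrite sqrtr_gt0 ltr0n.
move: (Num.sqrt n%:R) (Num.sqrt d%:R) => s t s0 nE t0 dE ts.
(* This value makes both terms of order r tau^2 sqrt (n d). *)
pose l := 16 * tau ^+ 2 * t * s / r.
have l0 : 0 < l by rewrite divr_gt0// !mulr_gt0// exprn_gt0.
pose N (S : n.-tuple {ffun 'I_d -> bool}) (j : 'I_d) := \sum_i (sgb (tnth S i j) - q j) : R.
apply: (@le_trans _ _ (\sum_S data_law q S *
    (- (l * r ^+ 2) - (2 * l)^-1 * \sum_j tau ^+ 4 * N S j ^+ 2))); last first.
  apply: ler_sum => S _; rewrite ler_wpM2l ?data_law_ge0// exchange_big/=.
  apply: (@le_trans _ _ (- (l / 2 * \sum_j a S j ^+ 2) -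
      (2 * l)^-1 * \sum_j tau ^+ 4 * N S j ^+ 2)).
    by rewrite lerD2r lerN2; have := a2 S; nra.
  rewrite mulr_sumr mulr_sumr -sumrN -sumrB; apply: ler_sum => j _.
  rewrite -mulr_sumr /score -mulr_sumr -/(N S j).
  have /andP[w0 w1] := omb j.
  have w2 : score_weight tau (q j) ^+ 2 * N S j ^+ 2 <= tau ^+ 4 * N S j ^+ 2.
    rewrite ler_wpM2r ?sqr_ge0// (_ : tau ^+ 4 = tau ^+ 2 ^+ 2); last by rewrite -exprM.
    by rewrite ler_sqr ?nnegrE// sqr_ge0.
  apply: (@le_trans _ _ (- (l / 2 * a S j ^+ 2) -
      (2 * l)^-1 * (score_weight tau (q j) ^+ 2 * N S j ^+ 2))).
    by rewrite lerD2l lerN2 ler_wpM2l// invr_ge0 mulr_ge0// ltW.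
  rewrite -subr_ge0.
  have -> : a S j * (score_weight tau (q j) * N S j) -
     (- (l / 2 * a S j ^+ 2) - (2 * l)^-1 * (score_weight tau (q j) ^+ 2 * N S j ^+ 2)) =
     (2 * l)^-1 * (l * a S j + score_weight tau (q j) * N S j) ^+ 2.
    by field; rewrite gt_eqF.
  by rewrite mulr_ge0 ?sqr_ge0// invr_ge0 mulr_ge0// ltW.
have -> : \sum_S data_law q S *
    (- (l * r ^+ 2) - (2 * l)^-1 * \sum_j tau ^+ 4 * N S j ^+ 2) =
  - (l * r ^+ 2) - (2 * l)^-1 * (tau ^+ 4 *
     \sum_j \sum_S data_law q S * N S j ^+ 2).
  under eq_bigr do rewrite mulrBr.
  rewrite sumrB -mulr_suml sum_data_law mul1r exchange_big/= mulr_sumr mulr_sumr.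
  congr (_ - _); apply: eq_bigr => S _.
  by rewrite -!mulr_sumr; ring.
have H : \sum_j \sum_S data_law q S * N S j ^+ 2 <= t ^+ 2 * (256 * s ^+ 2).
  rewrite (_ : t ^+ 2 * _ = \sum_(j < d) 256 * n%:R); last first.
    by rewrite sumr_const card_ord -dE -nE -[RHS]mulr_natl.
  by apply: ler_sum => j _; apply: data_law_sqr.
have il0 : 0 <= (2 * l)^-1 by rewrite invr_ge0 mulr_ge0// ltW.
have t4 : 0 <= tau ^+ 4 by rewrite exprn_ge0// ltW.
have := ler_wpM2l il0 (ler_wpM2l t4 H).
have -> : (2 * l)^-1 * (tau ^+ 4 * (t ^+ 2 * (256 * s ^+ 2))) =
  8 * r * tau * t * (tau * s).
  by rewrite /l; field; rewrite !gt_eqF.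
have -> : l * r ^+ 2 = 16 * r * tau * t * (tau * s).
  by rewrite /l; field; rewrite !gt_eqF.
have rtt : 0 <= r * tau * t by rewrite !mulr_ge0// ltW.
have := ler_wpM2l rtt ts.
lra.
Qed.

Definition anticorrelation A z : R := - \sum_j A j * score tau q z j.

(** The scores are centered, so a vector that does not depend on the sample is
uncorrelated with its score. *)
Lemma sum_anticorrelation A : \sum_z sign_law q z * anticorrelation A z = 0.
Proof.
rewrite /anticorrelation; under eq_bigr do rewrite mulrN mulr_sumr.
rewrite sumrN exchange_big/= big1 ?oppr0// => j _.
rewrite (_ : \sum_z _ = A j * score_weight tau (q j) *
   (\sum_z sign_law q z * sgb (z j) - (\sum_z sign_law q z) * q j)); last first.
  rewrite mulr_suml -sumrB mulr_sumr; apply: eq_bigr => z _.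
  by rewrite /score; ring.
by rewrite sign_law_mean sum_sign_law mul1r subrr mulr0.
Qed.

(** The height at which the correlation of an output with the score of a fresh sample has
bounded exponential moments. It is dimension-free since the coordinates are independent. *)
Definition mgf_scale := 4 * r * tau ^+ 2.

Lemma mgf_scale_gt0 : 0 < mgf_scale.
Proof. by rewrite /mgf_scale !mulr_gt0// exprn_gt0. Qed.

Lemma anticorrelation_mgf A (b : bool) : (forall j, `|A j| <= r) ->
  \sum_j A j ^+ 2 <= 2 * r ^+ 2 ->
  \sum_z sign_law q z * expR (sgb b * (anticorrelation A z / mgf_scale)) <= 4 / 3.
Proof.
move=> Ar A2; pose u j := - sgb b * (A j * score_weight tau (q j) / mgf_scale).
have K0 := mgf_scale_gt0.
rewrite (_ : \sum_z _ = \sum_z sign_law q z * expR (\sum_j u j * (sgb (z j) - q j))); last first.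
  apply: eq_bigr => z _; congr (_ * expR _).
  rewrite /anticorrelation mulNr mulrN -mulNr mulr_suml mulr_sumr; apply: eq_bigr => j _.
  by rewrite /u /score; ring.
apply: le_trans (sign_law_mgf q1 _) (le_trans _ expR_quarter) => [j|].
  have /andP[w0 w1] := omb j.
  rewrite /u normrM normrN (_ : `|sgb b| = 1); last by case: b {u}; rewrite /sgb ?normrN normr1.
  rewrite mul1r 2!normrM normfV (ger0_norm w0) (gtr0_norm K0) ler_pdivrMr//.
  have := ler_pM (normr_ge0 _) w0 (Ar j) w1; rewrite /mgf_scale; lra.
rewrite ler_expR.
apply: (@le_trans _ _ (2 * \sum_j (16 * r ^+ 2)^-1 * A j ^+ 2)).
  rewrite ler_pM2l//; apply: ler_sum => j _.
  have /andP[w0 w1] := omb j.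
  have w2 : (score_weight tau (q j) / mgf_scale) ^+ 2 <= (16 * r ^+ 2)^-1.
    rewrite (_ : (16 * r ^+ 2)^-1 = (tau ^+ 2 / mgf_scale) ^+ 2); last first.
      by rewrite /mgf_scale; field; rewrite !gt_eqF.
    have iK : 0 <= mgf_scale^-1 by rewrite invr_ge0 ltW.
    rewrite ler_sqr ?nnegrE; first by rewrite ler_wpM2r.
      exact: mulr_ge0.
    by rewrite mulr_ge0// sqr_ge0.
  rewrite /u exprMn sqrrN sgb_sqr mul1r -(mulrA (A j)) exprMn mulrC ler_wpM2r ?sqr_ge0//.
rewrite -mulr_sumr.
have i0 : 0 <= (16 * r ^+ 2)^-1 by rewrite invr_ge0 mulr_ge0// sqr_ge0.
have := ler_wpM2l i0 A2.
rewrite (_ : (16 * r ^+ 2)^-1 * (2 * r ^+ 2) = 8^-1); last by field; rewrite gt_eqF.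
lra.
Qed.

(** The worst case over samples, larger than the typical size [mgf_scale] by a factor
[sqrt d]; it is only ever multiplied by [delta]. *)
Lemma anticorrelation_norm A z : (0 < d)%N -> \sum_j A j ^+ 2 <= 2 * r ^+ 2 ->
  `|anticorrelation A z| <= 4 * tau ^+ 2 * r * Num.sqrt d%:R.
Proof.
move=> d0 A2.
have dE : d%:R = Num.sqrt d%:R ^+ 2 :> R by rewrite sqr_sqrtr.
have t0 : 0 < Num.sqrt d%:R :> R by rewrite sqrtr_gt0 ltr0n.
rewrite normrN (le_trans (ler_norm_sum _ _ _))//.
move: (Num.sqrt d%:R) dE t0 => t dE t0.
apply: (@le_trans _ _ (\sum_j (A j ^+ 2 * (t / (2 * r)) + r / (2 * t)) * (2 * tau ^+ 2))).
  apply: ler_sum => j _; rewrite normrM ler_pM ?score_norm//.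
  rewrite -real_normK ?num_real// -subr_ge0.
  rewrite (_ : _ - _ = (t * `|A j| - r) ^+ 2 / (2 * r * t)).
    by rewrite divr_ge0 ?sqr_ge0// !mulr_ge0// ltW.
  by field; rewrite !gt_eqF.
rewrite -mulr_suml big_split/= -mulr_suml sumr_const card_ord -[_ *+ d]mulr_natl dE.
have i0 : 0 <= t / (2 * r) by rewrite divr_ge0 ?mulr_ge0// ltW.
have := ler_wpM2r i0 A2.
rewrite (_ : 2 * r ^+ 2 * (t / (2 * r)) = r * t); last by field; rewrite gt_eqF.
rewrite (_ : t ^+ 2 * (r / (2 * t)) = r * t / 2); last by field; rewrite gt_eqF.
have := sqr_ge0 tau; have : 0 <= r * t by rewrite mulr_ge0 ?ltW.
nra.
Qed.

End scores.

Definition replace_sample n (T : Type) (S : n.-tuple T) (i : 'I_n) (t : T) : n.-tuple T :=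
  [tuple if k == i then t else tnth S k | k < n].

(** A sample and a fresh independent copy of it are exchangeable. *)
Lemma resample_sum (R : realType) d n (q : 'I_d -> R) (i : 'I_n)
    (F : n.-tuple {ffun 'I_d -> bool} -> {ffun 'I_d -> bool} -> R) :
  \sum_S \sum_z data_law q S * sign_law q z * F (replace_sample S i z) (tnth S i) =
  \sum_S \sum_z data_law q S * sign_law q z * F S z.
Proof.
rewrite !pair_bigA/=.
pose g (p : n.-tuple {ffun 'I_d -> bool} * {ffun 'I_d -> bool}) :=
  (replace_sample p.1 i p.2, tnth p.1 i).
have gK : involutive g.
  case=> S z; congr (_, _); last by rewrite tnth_mktuple eqxx.
  by apply/eq_from_tnth => k; rewrite !tnth_mktuple; case: eqP => // ->.
rewrite [RHS](reindex_inj (inv_inj gK)); apply: eq_bigr => -[S z] _ /=.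
congr (_ * _); rewrite /data_law (bigD1 i)//= [in RHS](bigD1 i)//= tnth_mktuple eqxx.
rewrite mulrAC [RHS]mulrAC [sign_law q z * _]mulrC; congr (_ * _).
by apply: eq_bigr => k /negbTE ki; rewrite tnth_mktuple ki.
Qed.

(** * Finite probability spaces *)

(** Immediate from the definition of the integral by suprema over simple functions. It
applies to functions given by suprema over uncountable sets, whose measurability is
unclear. *)
Lemma le_integralT d (T : measurableType d) (R : realType)
    (mu : {measure set T -> \bar R}) (f g : T -> \bar R) :
  (forall x, f x <= g x)%E -> (\int[mu]_x f x <= \int[mu]_x g x)%E.
Proof.
move=> fg; rewrite integralE [leRHS]integralE.
apply: leeB; rewrite !ge0_integralTE//; apply: le_ereal_sup => _ [h hf <-];
  exists h => // x; apply: le_trans (hf x) _.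
- by apply: (@funepos_le _ _ setT f g) => //; rewrite inE.
- by apply: (@funeneg_le _ _ setT f g) => //; rewrite inE.
Qed.

HB.instance Definition _ (T : finType) (U : pointedType) :=
  isPointed.Build {ffun T -> U} [ffun=> point].

HB.instance Definition _ (T : finType) (U : pointedType) :=
  @isMeasurable.Build default_measure_display {ffun T -> U}
    discrete_measurable discrete_measurable0
    discrete_measurableC discrete_measurableU.

Section finite_measurable.
Context d (T : measurableType d) (R : realType) (I : finType).
Variables (g : I -> T) (h : T -> I).
Hypotheses (gK : cancel g h) (hK : cancel h g).
Hypothesis measurable_pt : forall i, measurable [set g i].

Lemma finite_measurable (A : set T) : measurable A.
Proof.
rewrite (_ : A = \bigcup_(i in [set i | A (g i)]) [set g i]).
  by apply: fin_bigcup_measurable => [|i _]; [exact: finite_finset|].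
apply/seteqP; split => [x Ax|x [i Agi ->]//].
by exists (h x); rewrite /= hK.
Qed.

Variable mu : probability T R.

Let mu_pt i : (fine (mu [set g i]))%:E = mu [set g i].
Proof. by rewrite fineK// fin_num_measure. Qed.

Lemma finite_integrable (f : T -> R) : mu.-integrable setT (EFin \o f).
Proof.
apply: measurable_bounded_integrable => //.
- by rewrite (le_lt_trans (probability_le1 mu _))// ltry.
- by move=> _ A _; exact: finite_measurable.
exists (\sum_i `|f (g i)|); split; first exact: num_real.
move=> M lM x _; apply: le_trans (ltW lM).
by rewrite -[x]hK (bigD1 (h x))//= hK lerDl sumr_ge0.
Qed.

Lemma finite_integral (f : T -> R) :
  (\int[mu]_x (f x)%:E)%E = (\sum_i f (g i) * fine (mu [set g i]))%:E.
Proof.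
transitivity (\int[mu]_x (\sum_i (f (g i))%:E * (\1_[set g i] x)%:E))%E.
  apply: eq_integral => x _.
  rewrite (bigD1 (h x))//= hK indicE mem_set// mule1 big1 ?adde0// => i.
  move=> ix; rewrite indicE memNset ?mule0//= => xE.
  by move: ix; rewrite xE gK eqxx.
have int_i i : mu.-integrable setT (fun x => (f (g i))%:E * (\1_[set g i] x)%:E)%E.
  by apply: integrableZl => //; exact: integrable_indic.
rewrite (integral_sum measurableT int_i) -sumEFin; apply: eq_bigr => i _.
rewrite integralZl//; last exact: integrable_indic.
by rewrite integral_indic// setIT EFinM mu_pt.
Qed.

End finite_measurable.

Section finite_law.
Context {R : realType} {d : nat}.
Variable p : {ffun 'I_d -> bool} -> R.
Hypotheses (p0 : forall z, 0 <= p z) (p1 : \sum_z p z = 1).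

Let Z := {ffun 'I_d -> bool}.

Let atom (k : nat) : {measure set Z -> \bar R} :=
  let z := nth [ffun=> true] (enum Z) k in
  mscale (NngNum (p0 z)) (@dirac _ Z z R).

Definition finite_law : set Z -> \bar R := msum atom #|Z|.

HB.instance Definition _ := Measure.on finite_law.

Lemma finite_lawE (A : set Z) :
  finite_law A = (\sum_(z | z \in A) p z)%:E.
Proof.
rewrite /finite_law /msum -sumEFin [RHS]big_mkcond/=.
rewrite [RHS](reindex (fun k : 'I_#|Z| => enum_val k)) /=; last first.
  by apply: onW_bij; exact: enum_val_bij.
apply: eq_bigr => k _.
rewrite /atom /= /mscale/= diracE -(enum_val_nth [ffun=> true]).
by case: ifPn; rewrite /= ?mule1 ?mule0.
Qed.

Let finite_lawT : finite_law setT = 1%E.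
Proof. by rewrite finite_lawE (eq_bigl xpredT) ?p1// => z; rewrite in_setT. Qed.

HB.instance Definition _ := Measure_isProbability.Build _ _ _ finite_law finite_lawT.

(** Packages the law with the proof that its weights sum to [1], which unification
cannot recover from [finite_law] alone. *)
Definition finite_probability : probability Z R := finite_law.

Lemma finite_probability1 z : finite_probability [set z] = (p z)%:E.
Proof.
rewrite /= finite_lawE (eq_bigl (pred1 z)) ?big_pred1_eq// => y.
by apply/idP/eqP => [|->]; rewrite inE.
Qed.

End finite_law.

Section iid_finite.
Context {R : realType} {d : nat}.
Let Z := {ffun 'I_d -> bool}.
Variables (P : probability Z R) (p : Z -> R).
Hypothesis Pp : forall z, P [set z] = (p z)%:E.

Lemma measurable_tuple1 n (S : n.-tuple Z) : measurable [set S].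
Proof.
rewrite (_ : [set S] = \bigcap_(i in [set: 'I_n]) (@tnth n Z ^~ i) @^-1` [set tnth S i]).
  apply: fin_bigcap_measurable => // i _.
  rewrite -[X in measurable X]setTI; apply: measurable_tnth => //.
apply/seteqP; split => [_ -> i _//|S' H].
by apply/eq_from_tnth => i; apply: (H i).
Qed.

Lemma iid1 n (S : n.-tuple Z) : iid P n [set S] = (\prod_i p (tnth S i))%:E.
Proof.
elim: n S => [|n IH] S.
  by rewrite tuple0 /= diracE mem_set// big_ord0.
rewrite /= /distribution /pushforward.
pose S1 : n.-tuple Z := [tuple of behead S].
rewrite (_ : _ @^-1` _ = [set thead S] `*` [set S1]).
  rewrite product_measure1E//; last exact: measurable_tuple1.
  rewrite [X in (_ * X)%E]IH [X in (X * _)%E]Pp -EFinM big_ord_recl; congr (_ * _)%:E.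
  apply: eq_bigr => i _; rewrite tnth_behead; congr (p (tnth S _)).
  by apply/val_inj; rewrite /= inordK ?ltnS.
apply/seteqP; split => [[z S'] /= SE|[z S'] /= [-> ->]].
  by rewrite /S1 -SE; split; [rewrite theadE|apply/val_inj].
by rewrite [RHS]tuple_eta; apply/val_inj.
Qed.

Lemma iid_integral n (f : n.-tuple Z -> R) :
  (\int[iid P n]_S (f S)%:E)%E = (\sum_S (\prod_i p (tnth S i)) * f S)%:E.
Proof.
rewrite (@finite_integral _ _ _ (n.-tuple Z) id id) => [|//|//|S].
  by congr _%:E; apply: eq_bigr => S _; rewrite iid1/= mulrC.
exact: measurable_tuple1.
Qed.

End iid_finite.

(** * Expectations of bounded functions *)

(** A layer-cake formula with steps of height [u], off by at most one step. *)
Lemma staircase (R : realFieldType) (N : nat) (u y : R) :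
  0 < u -> 0 <= y -> y <= N%:R * u ->
  y <= \sum_(k < N) u * (k%:R * u < y)%R%:R <= y + u.
Proof.
move=> u0 y0 yN.
suff : Num.min y (N%:R * u) <= \sum_(k < N) u * (k%:R * u < y)%R%:R <= y + u.
  by rewrite min_l.
elim: N {yN} => [|N IH].
  by rewrite big_ord0 mul0r ge_min lexx orbT/= addr_ge0// ltW.
rewrite big_ord_recr/=.
have le_Nu : \sum_(k < N) u * (k%:R * u < y)%R%:R <= N%:R * u.
  rewrite mulr_natl -[N in _ *+ N]card_ord -sumr_const ler_sum// => k _.
  by rewrite ler_piMr ?(ltW u0)//; case: (_ < _).
move: le_Nu IH; set s := \sum_(k < N) _ => le_Nu /andP[lo hi].
rewrite -natr1 mulrDl mul1r; have [yN|yN] := ltP (N%:R * u) y.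
  rewrite mulr1; apply/andP; split; last by lra.
  move: lo; rewrite min_r ?(ltW yN)// => lo.
  by rewrite (le_trans (_ : _ <= N%:R * u + u)) ?ge_min ?lexx ?orbT// lerD2r.
rewrite mulr0 addr0 hi andbT; move: lo; rewrite min_l// => lo.
by rewrite ge_min lo.
Qed.

Section bounded_expectation.
Context d (W : measurableType d) (R : realType) (mu : probability W R).
Implicit Types f g : W -> R.

Definition bounded_measurable f :=
  measurable_fun setT f /\ exists B, forall w, `|f w| <= B.

Lemma bm_integrable f : bounded_measurable f -> mu.-integrable setT (EFin \o f).
Proof.
move=> [mf [B fB]]; apply: measurable_bounded_integrable => //.
  by rewrite (le_lt_trans (probability_le1 mu _))// ltry.
exists B; split; first exact: num_real.
by move=> M BM w _; apply: le_trans (ltW BM).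
Qed.

Lemma bm_cst (r : R) : bounded_measurable (fun=> r).
Proof. by split; [exact: measurable_cst|exists `|r|]. Qed.

Lemma bmD f g : bounded_measurable f -> bounded_measurable g ->
  bounded_measurable (fun w => f w + g w).
Proof.
move=> [mf [B fB]] [mg [C gC]]; split; first exact: measurable_funD.
by exists (B + C) => w; rewrite (le_trans (ler_normD _ _))// lerD.
Qed.

Lemma bmM f g : bounded_measurable f -> bounded_measurable g ->
  bounded_measurable (fun w => f w * g w).
Proof.
move=> [mf [B fB]] [mg [C gC]]; split; first exact: measurable_funM.
by exists (B * C) => w; rewrite normrM ler_pM.
Qed.

Lemma bmZ (r : R) f : bounded_measurable f ->
  bounded_measurable (fun w => r * f w).
Proof. by apply: bmM; exact: bm_cst. Qed.

Lemma bmN f : bounded_measurable f -> bounded_measurable (fun w => - f w).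
Proof.
by move=> /(bmZ (-1)); congr bounded_measurable; apply/funext => w; rewrite mulN1r.
Qed.

Lemma bm_sum (I : finType) (f : I -> W -> R) :
  (forall i, bounded_measurable (f i)) ->
  bounded_measurable (fun w => \sum_i f i w).
Proof.
move=> bf; elim: (index_enum I) => [|i s IH].
  by under eq_fun do rewrite big_nil; exact: bm_cst.
by under eq_fun do rewrite big_cons; exact: bmD.
Qed.

Lemma bm_max0 f : bounded_measurable f ->
  bounded_measurable (fun w => Num.max 0 (f w)).
Proof.
move=> [mf [B fB]]; split; first by apply: measurable_maxr.
exists B => w; apply: le_trans (fB w).
by rewrite ger0_norm ?le_max ?lexx// ge_max normr_ge0 ler_norm.
Qed.

Lemma bm_norm f : bounded_measurable f ->
  bounded_measurable (fun w => `|f w|).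
Proof.
move=> [mf [B fB]]; split; first exact: measurableT_comp.
by exists B => w; rewrite normr_id.
Qed.

Lemma bm_expR f : bounded_measurable f ->
  bounded_measurable (fun w => expR (f w)).
Proof.
move=> [mf [B fB]]; split; first exact: measurableT_comp.
exists (expR B) => w; rewrite ger0_norm ?expR_ge0// ler_expR.
by rewrite (le_trans (ler_norm _)).
Qed.

Lemma bm_indic f t : bounded_measurable f ->
  bounded_measurable (fun w => (t < f w)%R%:R : R).
Proof.
move=> [mf _]; split; last by exists 1 => w; case: (t < f w); rewrite ?normr1 ?normr0.
have -> : (fun w => (t < f w)%R%:R : R) = \1_[set w | t < f w].
  by apply/funext => w; rewrite indicE; congr ((nat_of_bool _)%:R); apply/idP/idP; rewrite inE.
apply/measurable_indicP.
by have := mf measurableT `]t, +oo[%classic; rewrite setTI preimage_itvoy; apply.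
Qed.

Lemma le_mean f g : bounded_measurable f -> bounded_measurable g ->
  (forall w, f w <= g w) -> \int[mu]_w f w <= \int[mu]_w g w.
Proof. by move=> bf bg fg; apply: le_Rintegral => //; exact: bm_integrable. Qed.

Lemma meanD f g : bounded_measurable f -> bounded_measurable g ->
  \int[mu]_w (f w + g w) = \int[mu]_w f w + \int[mu]_w g w.
Proof. by move=> bf bg; rewrite RintegralD//; exact: bm_integrable. Qed.

Lemma meanZ (r : R) f : bounded_measurable f ->
  \int[mu]_w (r * f w) = r * \int[mu]_w f w.
Proof. by move=> bf; rewrite RintegralZl//; exact: bm_integrable. Qed.

Lemma mean_cst (r : R) : \int[mu]_w (fun=> r) w = r.
Proof. by rewrite Rintegral_cst// [X in fine X]probability_setT mulr1. Qed.

Lemma mean_sum (I : finType) (f : I -> W -> R) :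
  (forall i, bounded_measurable (f i)) ->
  \int[mu]_w (\sum_i f i w) = \sum_i \int[mu]_w f i w.
Proof.
move=> bf; elim: (index_enum I) => [|i s IH].
  by under eq_Rintegral do rewrite big_nil; rewrite big_nil mean_cst.
under eq_Rintegral do rewrite big_cons.
rewrite meanD// ?IH ?big_cons//; elim: s {IH} => [|j s IH].
  by under eq_fun do rewrite big_nil; exact: bm_cst.
by under eq_fun do rewrite big_cons; exact: bmD.
Qed.

Lemma mean_tail f t : bounded_measurable f ->
  (\int[mu]_w (t < f w)%R%:R)%:E = mu [set w | t < f w].
Proof.
move=> bf; have [mi _] := bm_indic t bf.
have mA : measurable [set w | t < f w].
  have [mf _] := bf.
  by have := mf measurableT `]t, +oo[%classic; rewrite setTI preimage_itvoy; apply.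
rewrite /Rintegral fineK; last exact: integrable_fin_num (bm_integrable (bm_indic t bf)).
rewrite -[X in mu X]setIT -(integral_indic mu measurableT mA).
apply: eq_integral => w _.
by rewrite indicE; congr ((nat_of_bool _)%:R%:E); apply/idP/idP; rewrite inE.
Qed.

(** Differential privacy compares probabilities of events; the layer-cake formula extends
the comparison to expectations, where the additive term is paid once per unit of
height, hence [b * B] in total. *)
Lemma tail_domination f g (k b B : R) : 0 < B -> 0 <= k ->
  bounded_measurable f -> bounded_measurable g ->
  (forall w, 0 <= f w <= B) -> (forall w, 0 <= g w <= B) ->
  (forall t : R, 0 <= t ->
    (mu [set w | (t < f w)%R] <= k%:E * mu [set w | (t < g w)%R] + b%:E)%E) ->
  \int[mu]_w f w <= k * \int[mu]_w g w + b * B.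
Proof.
move=> B0 k0 bf bg fB gB H; apply/ler_addgt0Pr => e e0.
pose N := (Num.bound (k * B / e)).+1.
have N0 : 0 < N%:R :> R by rewrite ltr0n.
pose u := B / N%:R.
have u0 : 0 < u by rewrite divr_gt0.
have NuB : N%:R * u = B by rewrite /u mulrCA divff ?mulr1// gt_eqF.
have kue : k * u <= e.
  rewrite /u mulrA ler_pdivrMr// -ler_pdivrMl// mulrC ltW//.
  rewrite (lt_le_trans (archi_boundP _)) ?ler_nat//.
  by rewrite divr_ge0 ?mulr_ge0 ?(ltW B0) ?(ltW e0).
pose st (h : W -> R) w := \sum_(j < N) u * (j%:R * u < h w)%R%:R.
have stb h : bounded_measurable h -> bounded_measurable (st h).
  by move=> bh; apply: bm_sum => j; apply: bmZ; exact: bm_indic.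
have stP (h : W -> R) w : 0 <= h w <= B -> h w <= st h w <= h w + u.
  by move=> /andP[h0 hB]; apply: staircase; rewrite ?NuB.
have stE h : bounded_measurable h -> \int[mu]_w st h w =
    \sum_(j < N) u * \int[mu]_w (j%:R * u < h w)%R%:R.
  move=> bh; rewrite mean_sum => [|j]; last by apply: bmZ; exact: bm_indic.
  by apply: eq_bigr => j _; rewrite meanZ//; exact: bm_indic.
have f_st : \int[mu]_w f w <= \int[mu]_w st f w.
  by apply: le_mean => //; [exact: stb|move=> w; case/andP: (stP _ _ (fB w))].
have st_g : \int[mu]_w st g w <= \int[mu]_w g w + u.
  rewrite -[u in leRHS](mean_cst u) -meanD//; last exact: bm_cst.
  apply: le_mean; [exact: stb|by apply: bmD => //; exact: bm_cst|].
  by move=> w; case/andP: (stP _ _ (gB w)).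
have st_fg : \int[mu]_w st f w <= k * \int[mu]_w st g w + b * B.
  rewrite !stE// -NuB -!mulr_sumr.
  set X := \sum_(j < N) \int[mu]_w _; set Y := \sum_(j < N) _.
  rewrite (_ : k * (u * Y) + _ = u * (k * Y + N%:R * b)); last by ring.
  rewrite ler_wpM2l ?(ltW u0)// /X /Y mulr_sumr mulr_natl.
  rewrite -[N in _ *+ N]card_ord -sumr_const -big_split.
  apply: ler_sum => j _ /=; rewrite -lee_fin EFinD EFinM !mean_tail//.
  by apply: H; rewrite mulr_ge0// ltW.
have := ler_wpM2l k0 st_g; lra.
Qed.

End bounded_expectation.

(** * Privacy limits correlation with the samples *)

Section privacy_loss.
Context {R : realType}.
Variables (eps K : R).
Hypotheses (eps0 : 0 < eps) (K0 : 0 < K).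

(** An upper bound for the value [y] under one law by an expectation under another law
whose likelihood ratio is at most [expR eps]. For small [eps] the loss is proportional to
[eps * `|y|]; for large [eps] the values below [eps * K] are kept, and the tail above is
paid for by an exponential moment at scale [K]. *)
Definition privacy_cost (y : R) : R :=
  if eps <= 2^-1 then y + 2 * eps * `|y| else eps * K + K * expR (y / K).

Lemma bm_privacy_cost d (W : measurableType d) (f : W -> R) :
  bounded_measurable f -> bounded_measurable (fun w => privacy_cost (f w)).
Proof.
move=> bf; rewrite /privacy_cost; case: (eps <= 2^-1).
  by apply: bmD => //; apply: bmZ; exact: bm_norm.
apply: bmD; first exact: bm_cst.
by apply: bmZ; apply: bm_expR; apply: bmM => //; exact: bm_cst.
Qed.

(** For small [eps], positive and negative parts are compared separately, with the roles
of [f] and [g] exchanged for the negative parts. For large [eps], only the part of [f]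
above [eps * K] is compared, and the exponential tail of [g] absorbs the factor
[expR eps]. *)
Lemma expectation_transfer d (W : measurableType d) (mu : probability W R)
    (f g : W -> R) (delta B : R) :
  0 < B -> 0 <= delta ->
  bounded_measurable f -> bounded_measurable g ->
  (forall w, `|f w| <= B) -> (forall w, `|g w| <= B) ->
  (forall t : R, (mu [set w | (t < f w)%R] <=
     (expR eps)%:E * mu [set w | (t < g w)%R] + delta%:E)%E) ->
  (forall t : R, (mu [set w | (t < - g w)%R] <=
     (expR eps)%:E * mu [set w | (t < - f w)%R] + delta%:E)%E) ->
  \int[mu]_w f w <= \int[mu]_w privacy_cost (g w) + 2 * (delta * B).
Proof.
move=> B0 d0 bf bg fB gB Hf Hg; have e0 := eps0.
have dB : 0 <= delta * B by rewrite mulr_ge0// ltW.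
have part (f' g' : W -> R) (th : R) : 0 <= th ->
    bounded_measurable f' -> bounded_measurable g' ->
    (forall w, `|f' w| <= B) -> (forall w, `|g' w| <= B) ->
    (forall t : R, (mu [set w | (t < f' w)%R] <=
       (expR eps)%:E * mu [set w | (t < g' w)%R] + delta%:E)%E) ->
    \int[mu]_w Num.max 0 (f' w - th) <=
      expR eps * \int[mu]_w Num.max 0 (g' w - th) + delta * B.
  move=> th0 bf' bg' f'B g'B H.
  have bmB (h : W -> R) : bounded_measurable h -> bounded_measurable (fun w => Num.max 0 (h w - th)).
    by move=> bh; apply: bm_max0; apply: bmD => //; exact: bm_cst.
  have maxB (y : R) : `|y| <= B -> 0 <= Num.max 0 (y - th) <= B.
    move=> yB; rewrite le_max lexx/= ge_max (ltW B0)/=.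
    by have := ler_norm y; lra.
  apply: tail_domination => //; rewrite ?expR_ge0//.
  - exact: bmB.
  - exact: bmB.
  - by move=> w; apply: maxB.
  - by move=> w; apply: maxB.
  - move=> t t0; have tE (h : W -> R) : [set w | (t < Num.max 0 (h w - th))%R] =
        [set w | (t + th < h w)%R].
      apply/seteqP; split => w /=; rewrite lt_max (le_gtF t0)/= => ?; lra.
    by rewrite !tE.
(* The threshold th is 0 for small eps and eps * K for large eps. *)
rewrite /privacy_cost; case: (leP eps (2^-1)) => eps2.
  have Np (h : W -> R) : bounded_measurable h -> bounded_measurable (fun w => Num.max 0 (h w - 0)).
    by move=> bh; apply: bm_max0; apply: bmD => //; exact: bm_cst.
  have P := part f g 0 (lexx _) bf bg fB gB Hf.
  have N : \int[mu]_w Num.max 0 (- g w - 0) <=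
      expR eps * \int[mu]_w Num.max 0 (- f w - 0) + delta * B.
    by apply: part => //; [exact: bmN|exact: bmN|move=> w; rewrite normrN..].
  have split (h : W -> R) : bounded_measurable h -> \int[mu]_w h w =
      \int[mu]_w Num.max 0 (h w - 0) - \int[mu]_w Num.max 0 (- h w - 0).
    move=> bh; have bN := Np _ (bmN bh).
    rewrite -[- \int[mu]_w _]mulN1r -(meanZ mu (-1) bN) -(meanD mu (Np _ bh) (bmZ (-1) bN)).
    apply: eq_Rintegral => w _; rewrite !subr0 mulN1r.
    by case: (lerP 0 (h w)) => hw; [rewrite max_l|rewrite max_r]; lra.
  have nsplit (h : W -> R) : bounded_measurable h -> \int[mu]_w `|h w| =
      \int[mu]_w Num.max 0 (h w - 0) + \int[mu]_w Num.max 0 (- h w - 0).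
    move=> bh; rewrite -meanD; [|exact: Np|by apply: Np; exact: bmN].
    apply: eq_Rintegral => w _; rewrite !subr0.
    by case: (lerP 0 (h w)) => hw; [rewrite ger0_norm ?max_l|rewrite ltr0_norm ?max_r]; lra.
  rewrite meanD//; last by apply: bmZ; exact: bm_norm.
  rewrite meanZ; last exact: bm_norm.
  rewrite (split f)// (split g)// (nsplit g)//.
  have ge0 (h : W -> R) : 0 <= \int[mu]_w Num.max 0 (h w - 0).
    by apply: Rintegral_ge0 => w _; rewrite le_max lexx.
  have := ge0 g; have := ge0 f; have := ge0 (fun w => - g w); have := ge0 (fun w => - f w).
  move: P N.
  set F := \int[mu]_w Num.max 0 (f w - 0); set G := \int[mu]_w Num.max 0 (g w - 0).
  set F' := \int[mu]_w Num.max 0 (- f w - 0); set G' := \int[mu]_w Num.max 0 (- g w - 0).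
  move=> P N F'0 G'0 F0 G0.
  have e1 : expR eps <= 1 + 2 * eps.
    by apply: le_trans (expR_le_quadratic eps2) _; nra.
  have e2 : (1 - eps) * expR eps <= 1.
    rewrite -[leRHS](expRxMexpNx_1 eps) mulrC ler_wpM2l ?expR_ge0//.
    exact: expR_ge1Dx.
  have P' : F <= (1 + 2 * eps) * G + delta * B.
    by apply: le_trans P _; rewrite lerD2r ler_wpM2r.
  have N' : (1 - eps) * G' <= F' + delta * B.
    have e3 : 0 <= 1 - eps by lra.
    have := ler_wpM2l e3 N; rewrite mulrDr mulrA => h.
    apply: (le_trans h); rewrite lerD ?ler_piMl//; lra.
  nra.
have th0 : 0 <= eps * K by rewrite mulr_ge0 ?ltW.
have P := part f g _ th0 bf bg fB gB Hf.
have bmB (h : W -> R) : bounded_measurable h -> bounded_measurable (fun w => Num.max 0 (h w - eps * K)).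
  by move=> bh; apply: bm_max0; apply: bmD => //; exact: bm_cst.
have bme : bounded_measurable (fun w => K * expR (g w / K)).
  by apply: bmZ; apply: bm_expR; apply: bmM => //; exact: bm_cst.
have H1 : \int[mu]_w f w <= eps * K + \int[mu]_w Num.max 0 (f w - eps * K).
  rewrite -[X in _ <= X + _](mean_cst mu) -meanD; [|exact: bm_cst|exact: bmB].
  apply: le_mean => //; first by apply: bmD; [exact: bm_cst|exact: bmB].
  by move=> w; rewrite -lerBlDl le_max lexx orbT.
have H2 : expR eps * \int[mu]_w Num.max 0 (g w - eps * K) <= \int[mu]_w (K * expR (g w / K)).
  rewrite -meanZ; last exact: bmB.
  apply: le_mean => //; first by apply: bmZ; exact: bmB.
  move=> w; have -> : expR (g w / K) = expR eps * expR ((g w - eps * K) / K).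
    by rewrite -expRD; congr expR; field; rewrite gt_eqF.
  rewrite mulrCA ler_wpM2l ?expR_ge0// ge_max mulr_ge0 ?expR_ge0 ?(ltW K0)//=.
  rewrite -ler_pdivrMl// mulrC; apply: le_trans (expR_ge1Dx _).
  by rewrite lerDr.
rewrite meanD//; last exact: bm_cst.
rewrite mean_cst; lra.
Qed.

(** Centered variables with bounded exponential moments at scale [K] have privacy cost of
order [eps * K], in both regimes. *)
Lemma privacy_cost_mean (I : finType) (p h : I -> R) :
  (forall i, 0 <= p i) -> \sum_i p i = 1 -> \sum_i p i * h i = 0 ->
  \sum_i p i * expR (h i / K) <= 4 / 3 ->
  \sum_i p i * expR (- (h i / K)) <= 4 / 3 ->
  \sum_i p i * privacy_cost (h i) <= 6 * (eps * K).
Proof.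
move=> p0 p1 ph e1 e2; have e0 := eps0; have eK : 0 < eps * K by rewrite mulr_gt0.
rewrite /privacy_cost; case: (leP eps (2^-1)) => eps2.
  apply: (@le_trans _ _ (\sum_i (p i * h i + 2 * (eps * K) *
      (p i * expR (h i / K) + p i * expR (- (h i / K)))))).
    apply: ler_sum => i _; rewrite mulrDr lerD2l.
    rewrite [leRHS](_ : _ = eps * (2 * (p i *
      (K * (expR (h i / K) + expR (- (h i / K))))))); last by ring.
    rewrite [leLHS](_ : _ = eps * (2 * (p i * `|h i|))); last by ring.
    rewrite !ler_wpM2l ?(ltW eps0)//.
    have := norm_le_expR (h i / K).
    by rewrite normrM normfV (gtr0_norm K0) ler_pdivrMr// mulrC.
  rewrite big_split/= ph add0r -mulr_sumr big_split/=.
  by have := ler_wpM2l (ltW eK) (lerD e1 e2); lra.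
under eq_bigr do rewrite mulrDr.
rewrite big_split/= -mulr_suml p1 mul1r.
under eq_bigr do rewrite mulrCA.
rewrite -mulr_sumr.
have := ler_wpM2l (ltW K0) e1; nra.
Qed.

End privacy_loss.

Section private_correlation.
Context {R : realType} {d n : nat} {disp : measure_display}.
Context {W : measurableType disp} (mu : probability W R).
Let Z := {ffun 'I_d -> bool}.
Variables (A : W -> n.-tuple Z -> 'I_d -> R) (r eps delta tau : R).
Hypotheses (d0 : (0 < d)%N) (r0 : 0 < r) (eps0 : 0 < eps) (delta0 : 0 <= delta).
Hypotheses (tau0 : 0 < tau) (tau2 : tau <= 2^-1).
Hypothesis mA : forall S j, measurable_fun setT (fun w => A w S j).
Hypothesis Ar : forall w S j, `|A w S j| <= r.
Hypothesis A2 : forall w S, \sum_j A w S j ^+ 2 <= 2 * r ^+ 2.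

Definition mean_output S j : R := \int[mu]_w A w S j.

Let bmA S j : bounded_measurable (fun w => A w S j).
Proof. by split => //; exists r. Qed.

Lemma mean_output_le S j : `|mean_output S j| <= r.
Proof.
rewrite ler_norml; apply/andP; split.
- rewrite -(mean_cst mu (- r)); apply: le_mean => //; first exact: bm_cst.
  by move=> w; have := Ar w S j; rewrite ler_norml => /andP[].
- rewrite -(mean_cst mu r); apply: le_mean => //; first exact: bm_cst.
  by move=> w; rewrite (le_trans (ler_norm _)).
Qed.

Lemma mean_output_dot S (c : 'I_d -> R) :
  \sum_j c j * mean_output S j = \int[mu]_w \sum_j c j * A w S j.
Proof.
rewrite mean_sum => [|j]; last exact: bmZ.
by apply: eq_bigr => j _; rewrite meanZ.
Qed.

(** The mean of points of a ball lies in the ball. *)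
Lemma mean_output_sqr S : \sum_j mean_output S j ^+ 2 <= 2 * r ^+ 2.
Proof.
set s := \sum_j _.
suff : s <= r ^+ 2 + s / 2 by lra.
rewrite {1}/s; under eq_bigr do rewrite expr2.
rewrite mean_output_dot -(mean_cst mu (r ^+ 2 + s / 2)).
apply: le_mean; [|exact: bm_cst|].
  by apply: bm_sum => j; exact: bmZ.
move=> w; have := A2 w S; rewrite /s => AA.
have : \sum_j mean_output S j * A w S j <=
    \sum_j (A w S j ^+ 2 / 2 + mean_output S j ^+ 2 / 2).
  by apply: ler_sum => j _; have := sqr_ge0 (mean_output S j - A w S j); lra.
by rewrite big_split/= -!mulr_suml; lra.
Qed.

Hypothesis A_private : forall S S', neighbours S S' -> forall (c : 'I_d -> R) (t : R),
  (mu [set w | (t < \sum_j c j * A w S j)%R] <=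
   (expR eps)%:E * mu [set w | (t < \sum_j c j * A w S' j)%R] + delta%:E)%E.

Variable q : 'I_d -> R.
Hypothesis qt : forall j, `|q j| <= tau.

Let B := 4 * tau ^+ 2 * r * Num.sqrt d%:R.
Let K := mgf_scale tau r.

Let hs z w S := anticorrelation tau q (A w S) z.

Let hsE z w S : hs z w S = \sum_j - score tau q z j * A w S j.
Proof. by rewrite /hs /anticorrelation -sumrN; apply: eq_bigr => j _; rewrite mulrC mulNr. Qed.

Let bmh z S : bounded_measurable (hs z ^~ S).
Proof. by under eq_fun do rewrite hsE; apply: bm_sum => j; exact: bmZ. Qed.

(** By privacy, the output may be computed on data in which sample [i] was replaced by a
fresh one. After exchanging the two copies of sample [i], the output is independent of
the sample with which it is correlated. *)
Lemma private_sample_correlation (i : 'I_n) :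
  \sum_S data_law q S * \int[mu]_w hs (tnth S i) w S <=
  6 * (eps * K) + 2 * (delta * B).
Proof.
have q1 j : `|q j| <= 1 by apply: le_trans (qt j) (le_trans tau2 _); rewrite invf_le1 ?ler1n.
have K0 : 0 < K by apply: mgf_scale_gt0.
have B0 : 0 < B.
  by rewrite /B mulr_gt0 ?sqrtr_gt0 ?ltr0n// mulr_gt0// mulr_gt0// exprn_gt0.
have hB z w S : `|hs z w S| <= B by apply: anticorrelation_norm.
have nbr S z : neighbours S (replace_sample S i z).
  by exists i => j /negbTE ji; rewrite tnth_mktuple ji.
have nbr' S z : neighbours (replace_sample S i z) S.
  by exists i => j /negbTE ji; rewrite tnth_mktuple ji.
have step S z (z0 := tnth S i) : \int[mu]_w hs z0 w S <=
    \int[mu]_w privacy_cost eps K (hs z0 w (replace_sample S i z)) + 2 * (delta * B).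
  apply: expectation_transfer => //; try exact: bmh.
  - move=> t; under eq_set do rewrite hsE.
    by under [X in (_ <= _ * mu X + _)%E]eq_set do rewrite hsE; exact: A_private.
  - have hsNE S' w : - hs z0 w S' = \sum_j score tau q z0 j * A w S' j.
      by rewrite hsE -sumrN; apply: eq_bigr => j _; rewrite mulNr opprK.
    move=> t; under eq_set do rewrite hsNE.
    by under [X in (_ <= _ * mu X + _)%E]eq_set do rewrite hsNE; exact: A_private.
have pd0 S z : 0 <= data_law q S * sign_law q z by rewrite mulr_ge0 ?data_law_ge0 ?sign_law_ge0.
pose Phi S z := \int[mu]_w privacy_cost eps K (hs z w S).
apply: (@le_trans _ _ (\sum_S \sum_z data_law q S * sign_law q z *
    (Phi (replace_sample S i z) (tnth S i) + 2 * (delta * B)))).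
  apply: ler_sum => S _.
  rewrite [leLHS](_ : _ = \sum_z data_law q S * sign_law q z *
      \int[mu]_w hs (tnth S i) w S); last first.
    by rewrite -mulr_suml -mulr_sumr sum_sign_law mulr1.
  by apply: ler_sum => z _; rewrite ler_wpM2l//; exact: step.
rewrite (resample_sum q i (fun S z => Phi S z + 2 * (delta * B))).
rewrite (_ : \sum_S _ = \sum_S data_law q S * (\sum_z sign_law q z * Phi S z + 2 * (delta * B))); last first.
  apply: eq_bigr => S _; under eq_bigr do rewrite mulrDr -mulrA.
  by rewrite big_split/= -mulr_sumr -mulr_suml -mulr_sumr sum_sign_law mulr1 -mulrDr.
rewrite [leRHS](_ : _ = \sum_S data_law (n := n) q S *
    (6 * (eps * K) + 2 * (delta * B))); last first.
  by rewrite -mulr_suml sum_data_law mul1r.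
apply: ler_sum => S _.
rewrite ler_wpM2l ?data_law_ge0// lerD2r.
have bP z : bounded_measurable (fun w => privacy_cost eps K (hs z w S)).
  exact: bm_privacy_cost.
rewrite (_ : \sum_z _ = \int[mu]_w \sum_z sign_law q z * privacy_cost eps K (hs z w S)); last first.
  rewrite mean_sum => [|z]; last exact: bmZ.
  by apply: eq_bigr => z _; rewrite meanZ.
rewrite -[leRHS](mean_cst mu); apply: le_mean; [|exact: bm_cst|].
  by apply: bm_sum => z; exact: bmZ.
move=> w; apply: privacy_cost_mean => //.
- by move=> z; exact: sign_law_ge0.
- exact: sum_sign_law.
- exact: sum_anticorrelation.
- have := anticorrelation_mgf tau0 tau2 r0 qt true (Ar w S) (A2 w S).
  by under eq_bigr do rewrite /sgb mul1r.
- have := anticorrelation_mgf tau0 tau2 r0 qt false (Ar w S) (A2 w S).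
  by under eq_bigr do rewrite /sgb mulN1r.
Qed.

(** Of the budget [r * tau * sqrt d / 6], the constant [288] leaves one half to the loss in
[eps], and [96] one quarter to the loss in [delta]. *)
Lemma privacy_bound :
  n%:R * eps * tau * 288 <= Num.sqrt d%:R -> n%:R * delta <= 96^-1 ->
  - (r * tau * Num.sqrt d%:R / 6) <=
    \sum_S data_law q S *
      \sum_i \sum_j mean_output S j * score tau q (tnth S i) j.
Proof.
move=> He Hd.
have -> : \sum_S data_law q S *
      \sum_i \sum_j mean_output S j * score tau q (tnth S i) j =
    - \sum_i \sum_S data_law q S * \int[mu]_w hs (tnth S i) w S.
  rewrite exchange_big/= -sumrN; apply: eq_bigr => S _.
  rewrite -mulr_sumr -mulrN -sumrN; congr (_ * _); apply: eq_bigr => i _.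
  under eq_Rintegral do rewrite hsE.
  rewrite -mean_output_dot -sumrN; apply: eq_bigr => j _.
  by rewrite mulNr opprK mulrC.
rewrite lerN2.
apply: (@le_trans _ _ (n%:R * (6 * (eps * K) + 2 * (delta * B)))).
  rewrite mulr_natl -[n in _ *+ n]card_ord -sumr_const.
  by apply: ler_sum => i _; exact: private_sample_correlation.
rewrite /K /mgf_scale /B; move: (Num.sqrt d%:R) He => t He.
have rt : 0 <= r * tau by rewrite mulr_ge0 ?ltW.
have H1 := ler_wpM2l rt He.
have t0 : 0 <= t.
  by apply: le_trans _ He; rewrite !mulr_ge0 ?(ltW tau0) ?(ltW r0) ?(ltW eps0).
have H2 : n%:R * delta * (r * tau * t * tau) <= 96^-1 * (r * tau * t * tau).
  by apply: ler_wpM2r => //; rewrite !mulr_ge0 ?(ltW tau0) ?(ltW r0) ?(ltW eps0).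
have H3 : r * tau * t * tau <= r * tau * t * 2^-1.
  by apply: ler_wpM2l => //; rewrite !mulr_ge0 ?(ltW tau0) ?(ltW r0) ?(ltW eps0).
have H4 : 0 <= r * tau * t by rewrite mulr_ge0.
have -> : n%:R * (6 * (eps * (4 * r * tau ^+ 2)) + 2 * (delta * (4 * tau ^+ 2 * r * t))) =
  24 / 288 * (r * tau * (n%:R * eps * tau * 288)) + 8 * (n%:R * delta * (r * tau * t * tau)).
  by field.
lra.
Qed.

End private_correlation.

(** * Euclidean balls *)

Section euclidean_ball.
Context {R : realType}.

Lemma dot_ge0 n (x : 'rV[R]_n) : 0 <= dot x x.
Proof. by apply: sumr_ge0 => i _; rewrite -expr2 sqr_ge0. Qed.

Lemma enorm_le n (x : 'rV[R]_n) (l : R) : 0 <= l ->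
  (enorm x <= l) = (dot x x <= l ^+ 2).
Proof.
move=> l0; rewrite /enorm -[X in _ <= X]ger0_norm// -sqrtr_sqr.
by rewrite ler_sqrt// sqr_ge0.
Qed.

Lemma dotxx n (x : 'rV[R]_n) : dot x x = \sum_i x 0 i ^+ 2.
Proof. by apply: eq_bigr => i _; rewrite expr2. Qed.

Lemma dot_row_mx m n (x y : 'rV[R]_(m + n)) :
  dot x y = dot (lsubmx x) (lsubmx y) + dot (rsubmx x) (rsubmx y).
Proof.
by rewrite /dot big_split_ord; congr (_ + _); apply: eq_bigr => i _; rewrite !mxE.
Qed.

Lemma dotBr n (x y z : 'rV[R]_n) : dot x (y - z) = dot x y - dot x z.
Proof.
by rewrite -sumrB; apply: eq_bigr => i _; rewrite !mxE mulrBr.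
Qed.

Lemma dotDr n (x y z : 'rV[R]_n) : dot x (y + z) = dot x y + dot x z.
Proof.
by rewrite -big_split; apply: eq_bigr => i _; rewrite !mxE mulrDr.
Qed.

Lemma dotZr n (x y : 'rV[R]_n) a : dot x (a *: y) = a * dot x y.
Proof.
by rewrite mulr_sumr; apply: eq_bigr => i _; rewrite !mxE mulrCA.
Qed.

Lemma dotZl n (x y : 'rV[R]_n) a : dot (a *: x) y = a * dot x y.
Proof.
by rewrite mulr_sumr; apply: eq_bigr => i _; rewrite !mxE mulrA.
Qed.

Definition eball n (l : R) : set 'rV[R]_n := [set x | enorm x <= l].
Arguments eball n l x : clear implicits.

Lemma continuous_sum (T : topologicalType) n (f : 'I_n -> T -> R) :
  (forall i, continuous (f i)) -> continuous (fun x => \sum_i f i x).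
Proof.
by move=> cf; apply: continuous_big => // z; exact: add_continuous.
Qed.

Lemma compact_eball n (l : R) : 0 <= l -> compact (eball n l).
Proof.
move=> l0; apply: bounded_closed_compact.
  exists l; split; first exact: num_real.
  move=> M lM x; rewrite /= /eball/= enorm_le// dotxx => xl.
  apply: le_trans (ltW lM); rewrite [leLHS]/Num.norm/= mx_normrE.
  apply/bigmax_leP; split => //= -[i j] _ /=; rewrite ord1 {i}.
  rewrite -ler_sqr ?nnegrE// real_normK ?num_real//; apply: le_trans xl.
  by rewrite (bigD1 j)//= lerDl sumr_ge0// => k _; rewrite sqr_ge0.
rewrite (_ : eball n l = (fun x => dot x x) @^-1` [set y | y <= l ^+ 2]); last first.
  by apply/seteqP; split => x; rewrite /eball/= enorm_le.
apply: closed_comp; last exact: closed_le.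
move=> x _; apply: continuous_sum => i y.
by apply: continuousM; exact: coord_continuous.
Qed.

Lemma convex_eball n (l : R) : 0 <= l -> convex_set (eball n l).
Proof.
move=> l0 x y t; rewrite !inE /eball/= => xl yl.
have t0 : 0 <= t%:num :> R by [].
have t1 : t%:num <= 1 :> R by [].
move: xl yl; rewrite !enorm_le// !dotxx => xl yl.
apply: (@le_trans _ _ (t%:num * \sum_i x 0 i ^+ 2 + (1 - t%:num) * \sum_i y 0 i ^+ 2)).
  rewrite !mulr_sumr -big_split; apply: ler_sum => i _; rewrite !mxE/=.
  set s := t%:num in t0 t1 *; rewrite -subr_ge0.
  have -> : s * x 0 i ^+ 2 + (1 - s) * y 0 i ^+ 2 -
     (s * x 0 i + (1 - s) * y 0 i) ^+ 2 = s * (1 - s) * (x 0 i - y 0 i) ^+ 2 by ring.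
  by rewrite mulr_ge0 ?sqr_ge0// mulr_ge0// subr_ge0.
have t1' : 0 <= 1 - t%:num :> R by rewrite subr_ge0.
have := ler_wpM2l t0 xl; have := ler_wpM2l t1' yl; lra.
Qed.

End euclidean_ball.

Arguments eball {R} n l x.

(** * Linear saddle-point problems *)

Section linear_problem.
Context {R : realType} {dx dy : nat}.
Variables (kappa r : R).
Let Z := {ffun 'I_(dx + dy) -> bool}.

Definition sign_row (z : Z) : 'rV[R]_(dx + dy) := \row_j sgb (z j).

(** The gradient operator of each loss is the constant [kappa *: sign_row z]. *)
Definition linear_problem : sp_problem R dx dy :=
  @SPProblem R dx dy (eball dx r) (eball dy r) default_measure_display Z
    (fun z x y => kappa * (dot (lsubmx (sign_row z)) x - dot (rsubmx (sign_row z)) y)).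

Lemma linear_problem_class (L M D : R) : 0 <= L -> 0 <= D -> 0 <= kappa ->
  r = D / 4 -> kappa * Num.sqrt (dx + dy)%:R = M ->
  sp_class L M D linear_problem.
Proof.
move=> L0 D0 k0 rE kM; have r0 : 0 <= r by rewrite rE divr_ge0.
split.
- by split; exact: compact_eball.
- by split; exact: convex_eball.
- exists 0 => w; rewrite subr0 (_ : D / 2 / 2 = r); last by rewrite rE; field.
  rewrite enorm_le// dot_row_mx => wr.
  by split; rewrite /= /eball/= enorm_le//; apply: le_trans wr;
    rewrite ?lerDl ?lerDr dot_ge0.
- move=> z; split => [y _|x _] t x1 x2 _ _ /=;
    rewrite le_eqVlt; apply/orP; left; apply/eqP; rewrite convRE /=;
    rewrite {1}/conv /= dotDr !dotZr /unstable.onem /=; ring.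
move=> z; exists (fun=> kappa *: sign_row z).
  move=> x y _ _; exists (kappa *: lsubmx (sign_row z)), ((- kappa) *: rsubmx (sign_row z)).
  split.
  - move=> e e0; near=> x'; rewrite dotZl dotBr [X in `|X|](_ : _ = 0); last by rewrite /=; ring.
    by rewrite normr0 mulr_ge0 ?(ltW e0)// sqrtr_ge0.
  - move=> e e0; near=> y'; rewrite dotZl dotBr [X in `|X|](_ : _ = 0); last by rewrite /=; ring.
    by rewrite normr0 mulr_ge0 ?(ltW e0)// sqrtr_ge0.
  - by rewrite scaleNr opprK -scale_row_mx hsubmxK.
have en0 w1 w2 : enorm (w1 - w2 : 'rV[R]_(dx + dy)) >= 0 by rewrite sqrtr_ge0.
split => [w1 w2 _ _|w1 w2 _ _|w _].
- by rewrite subrr /dot big1// => i _; rewrite mxE mul0r.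
- rewrite subrr [X in X <= _](_ : _ = 0) ?mulr_ge0//.
  by rewrite /enorm /dot big1 ?sqrtr0// => i _; rewrite mxE mul0r.
rewrite enorm_le; last by rewrite -kM mulr_ge0 ?sqrtr_ge0.
rewrite dotZl dotZr dotxx -kM exprMn sqr_sqrtr// mulrA -expr2.
under eq_bigr do rewrite mxE sgb_sqr.
by rewrite sumr_const card_ord.
Unshelve. all: by end_near. Qed.

Lemma linear_problem_diameter (D : R) : 0 <= D -> r = D / 4 ->
  ediameter_le (domW linear_problem) D.
Proof.
move=> D0 rE; have r0 : 0 <= r by rewrite rE divr_ge0.
have inW w : domW linear_problem w -> dot w w <= 2 * r ^+ 2.
  by rewrite dot_row_mx => -[/=]; rewrite /eball/= !enorm_le// => *; lra.
move=> w1 w2 /inW h1 /inW h2; rewrite enorm_le//.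
apply: (@le_trans _ _ (2 * dot w1 w1 + 2 * dot w2 w2)); last first.
  rewrite rE in h1 h2; have := sqr_ge0 D; lra.
rewrite !dotxx !mulr_sumr -big_split; apply: ler_sum => i _; rewrite !mxE/=.
by have := sqr_ge0 (w1 0 i + w2 0 i); lra.
Qed.

Section population.
Variables (q : 'I_(dx + dy) -> R) (P : probability (Zt linear_problem) R).
Hypothesis PE : forall z : Z, P [set z] = (sign_law q z)%:E.

Lemma linear_problem_distribution : sp_distribution P.
Proof.
by move=> x y _ _; apply: (@finite_integrable _ Z R Z id id).
Qed.

Lemma linear_population x y : population P x y =
  kappa * (dot (lsubmx (\row_j q j)) x - dot (rsubmx (\row_j q j)) y).
Proof.
rewrite /population /Rintegral.
rewrite (@finite_integral _ Z R Z id id)//=.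
have E : forall z : Z, fine (P [set z]) = sign_law q z by move=> z; rewrite PE.
under eq_bigr do rewrite E -mulrA.
rewrite -mulr_sumr; congr (_ * _).
under eq_bigr do rewrite mulrBl.
rewrite sumrB; congr (_ - _).
  under eq_bigr do rewrite mulr_suml.
  rewrite exchange_big; apply: eq_bigr => j _ /=.
  transitivity (\sum_z sign_law q z * sgb (z (lshift dy j)) * x 0 j).
    by apply: eq_bigr => z _; rewrite !mxE; ring.
  by rewrite -mulr_suml sign_law_mean !mxE.
under eq_bigr do rewrite mulr_suml.
rewrite exchange_big; apply: eq_bigr => j _ /=.
transitivity (\sum_z sign_law q z * sgb (z (rshift dx j)) * y 0 j).
  by apply: eq_bigr => z _; rewrite !mxE; ring.
by rewrite -mulr_suml sign_law_mean !mxE.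
Qed.

End population.

Section algorithm.
Variables (n : nat) (A : algorithm n linear_problem).
Hypothesis A_feasible : feasible A.
Hypothesis r0 : 0 <= r.

Definition output (w : seed A) (S : n.-tuple Z) (j : 'I_(dx + dy)) : R :=
  row_mx (run w S).1 (run w S).2 0 j.

Lemma output_sqr w S : \sum_j output w S j ^+ 2 <= 2 * r ^+ 2.
Proof.
rewrite -[leLHS]dotxx dot_row_mx row_mxKl row_mxKr.
have [] := A_feasible w S; rewrite /= /eball/= !enorm_le// => *; lra.
Qed.

Lemma output_le w S j : `|output w S j| <= r.
Proof.
have [] := A_feasible w S; rewrite /= /eball/= !enorm_le// !dotxx.
move=> hx hy.
rewrite -ler_sqr ?nnegrE// real_normK ?num_real// /output -(fintype.splitK j); case: (fintype.split j) => k /=.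
  rewrite row_mxEl; apply: le_trans hx.
  by rewrite (bigD1 k)//= lerDl sumr_ge0// => i _; rewrite sqr_ge0.
rewrite row_mxEr; apply: le_trans hy.
by rewrite (bigD1 k)//= lerDl sumr_ge0// => i _; rewrite sqr_ge0.
Qed.

(** Half-spaces of outputs are the only events needed: they give the measurability of the
coordinates of the output and the tails of its linear functionals. *)
Lemma open_output_halfspace (c : 'I_(dx + dy) -> R) (t : R) :
  open [set p : 'rV[R]_dx * 'rV[R]_dy |
    t < \sum_j c j * row_mx p.1 p.2 0 j].
Proof.
apply: (@open_comp _ _ (fun p : 'rV[R]_dx * 'rV[R]_dy =>
  \sum_j c j * row_mx p.1 p.2 0 j) [set y | t < y]); last exact: open_gt.
move=> p _; apply: continuous_sum => j p'.
apply: continuousM; first exact: cst_continuous.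
rewrite -(fintype.splitK j); case: (fintype.split j) => k /=.
  rewrite (_ : (fun _ => _) = (fun p : 'rV[R]_dx * 'rV[R]_dy => p.1 0 k)); last first.
    by apply/funext => u; rewrite row_mxEl.
  by apply: (@continuous_comp _ _ _ fst (fun x : 'rV[R]_dx => x 0 k));
    [exact: cvg_fst|exact: coord_continuous].
rewrite (_ : (fun _ => _) = (fun p : 'rV[R]_dx * 'rV[R]_dy => p.2 0 k)); last first.
  by apply/funext => u; rewrite row_mxEr.
by apply: (@continuous_comp _ _ _ snd (fun x : 'rV[R]_dy => x 0 k));
  [exact: cvg_snd|exact: coord_continuous].
Qed.

Arguments open_output_halfspace c t : clear implicits.

Lemma measurable_output S j : measurable_fun setT (fun w => output w S j).
Proof.
apply: (measurability _ (RGenOInfty.measurableE R)) => _ [_ [t ->] <-].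
rewrite setTI preimage_itvoy.
have oE := open_output_halfspace (fun k => (k == j)%:R) t.
have := run_measurable (a := A) (@sub_sigma_algebra _ setT open _ oE).
move=> /(pair2_measurable S measurableT); rewrite setTI.
congr measurable; apply/seteqP; split => w /=; rewrite (bigD1 j)//= eqxx mul1r big1 ?addr0 => // k /negbTE ->;
  by rewrite mul0r.
Qed.

Lemma output_private eps delta : private eps delta A ->
  forall S S', neighbours S S' -> forall (c : 'I_(dx + dy) -> R) (t : R),
  (seed_law A [set w | (t < \sum_j c j * output w S j)%R] <=
   (expR eps)%:E * seed_law A [set w | (t < \sum_j c j * output w S' j)%R] +
   delta%:E)%E.
Proof.
move=> Ap S S' SS' c t; have oE := open_output_halfspace c t.
exact: (Ap S S' SS' _ (@sub_sigma_algebra _ setT open _ oE)).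
Qed.

(** The supremum in the gap is bounded below by its value at a point opposite to [q],
chosen without knowledge of the seed, so that it may be fixed before averaging. *)
Lemma weak_gap_ge (q : 'I_(dx + dy) -> R) (tau : R)
    (P : probability (Zt linear_problem) R) :
  (0 < dx + dy)%N -> 0 < tau -> (forall j, `|q j| <= tau) ->
  (forall z : Z, P [set z] = (sign_law q z)%:E) ->
  ((kappa * (\sum_S data_law q S * (\sum_j mean_output (seed_law A) output S j * q j) +
     r / (tau * Num.sqrt (dx + dy)%:R) * \sum_j q j ^+ 2))%:E <= weak_gap A P)%E.
Proof.
move=> d0 tau0 qt PE.
have sd0 : 0 < Num.sqrt (dx + dy)%:R :> R by rewrite sqrtr_gt0 ltr0n.
set s := Num.sqrt _ in sd0 *.
pose l := r / (tau * s).
have l0 : 0 <= l by rewrite divr_ge0// mulr_ge0 // ltW.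
(* Since |q| <= tau sqrt d, this point lies in the ball of radius r. *)
pose w0 : 'rV[R]_(dx + dy) := \row_j (- l * q j).
have bmo S j : bounded_measurable (fun w => output w S j).
  by split; [exact: measurable_output|exists r => w; exact: output_le].
pose gap w := \sum_S data_law q S * (kappa * (\sum_j q j * output w S j + l * \sum_j q j ^+ 2)).
have bgap : bounded_measurable gap.
  apply: bm_sum => S; do 2 apply: bmZ; apply: bmD; last exact: bm_cst.
  by apply: bm_sum => j; exact: bmZ.
apply: (@le_trans _ _ (\int[seed_law A]_w (gap w)%:E)%E).
  rewrite -[leRHS]fineK; last exact: integrable_fin_num (bm_integrable _ bgap).
  rewrite lee_fin -[leRHS]/(\int[seed_law A]_w gap w) le_eqVlt; apply/orP; left.
  apply/eqP; rewrite mean_sum; last first.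
    move=> S; do 2 apply: bmZ; apply: bmD; last exact: bm_cst.
    by apply: bm_sum => j; exact: bmZ.
  transitivity (\sum_S data_law q S * (kappa * (\sum_j q j * mean_output (seed_law A) output S j + l * \sum_j q j ^+ 2))).
    rewrite -/l; under [RHS]eq_bigr do rewrite mulrDr mulrDr.
    rewrite big_split/= -mulr_suml sum_data_law mul1r mulrDr; congr (_ + _).
    rewrite mulr_sumr; apply: eq_bigr => S _; rewrite mulrCA; congr (_ * (_ * _)).
    by apply: eq_bigr => j _; rewrite mulrC.
  apply: eq_bigr => S _; rewrite meanZ; last first.
    apply: bmZ; apply: bmD; last exact: bm_cst.
    by apply: bm_sum => j; exact: bmZ.
  congr (_ * _); rewrite meanZ; last first.
    by apply: bmD; [apply: bm_sum => j; exact: bmZ|exact: bm_cst].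
  congr (_ * _); rewrite meanD ?mean_cst; [|by apply: bm_sum => j; exact: bmZ|exact: bm_cst].
  by rewrite (mean_output_dot _ measurable_output output_le).
apply: le_integralT => w; apply: ereal_sup_ubound.
have w0l : domX linear_problem (lsubmx w0) /\ domY linear_problem (rsubmx w0).
  have : dot w0 w0 <= r ^+ 2.
    rewrite dotxx; apply: (@le_trans _ _ (\sum_(j < dx + dy) (l * tau) ^+ 2)).
      apply: ler_sum => j _; rewrite mxE mulNr sqrrN -real_normK ?num_real//.
      rewrite ler_sqr ?nnegrE//; last exact: (mulr_ge0 l0 (ltW tau0)).
      by rewrite normrM ger0_norm// ler_wpM2l.
    rewrite sumr_const card_ord -mulr_natl.
    have -> : (dx + dy)%:R = s ^+ 2 :> R by rewrite sqr_sqrtr.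
    rewrite le_eqVlt; apply/orP; left; apply/eqP; rewrite /l; field.
    by rewrite !gt_eqF.
  rewrite dot_row_mx /= /eball/= !enorm_le//.
  by have := dot_ge0 (lsubmx w0); have := dot_ge0 (rsubmx w0); split; lra.
exists (lsubmx w0, rsubmx w0) => //=.
rewrite (iid_integral PE); congr _%:E; apply: eq_bigr => S _; congr (_ * _).
rewrite !(linear_population PE) -mulrBr; congr (_ * _).
set Q := \row_j q j; set x := (run w S).1; set y := (run w S).2.
transitivity (dot Q (row_mx x y) - dot Q w0).
  by rewrite [dot Q (row_mx _ _)]dot_row_mx [dot Q w0]dot_row_mx row_mxKl row_mxKr; ring.
congr (_ + _); first by apply: eq_bigr => j _; rewrite mxE.
rewrite /dot -sumrN mulr_sumr; apply: eq_bigr => j _; rewrite !mxE; ring.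
Qed.

End algorithm.
End linear_problem.

Theorem proposition7p1 (R : realType) :
  exists2 c : R, 0 < c &
  forall delta : nat -> R,
  (forall n, 0 <= delta n) ->
  delta =o_\oo (fun n => n%:R^-1 : R) ->
  exists N : nat, forall n : nat, (N <= n)%N -> (0 < n)%N ->
  forall (dx dy : nat) (L M D eps : R), (0 < dx + dy)%N ->
  0 < L -> 0 < M -> 0 < D -> 0 < eps ->
  forall A : (forall pb : sp_problem R dx dy, algorithm n pb),
  (forall pb : sp_problem R dx dy, sp_class L M D pb ->
     feasible (A pb) /\ private eps (delta n) (A pb)) ->
  exists (pb : sp_problem R dx dy) (P : probability (Zt pb) R),
    [/\ sp_class L M D pb,
        sp_distribution P,
        ediameter_le (domW pb) D &
        ((c * (M * D * ((Num.sqrt n%:R)^-1 +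
            Num.min 1 (Num.sqrt (dx + dy)%:R / (eps * n%:R)))))%:E
         <= weak_gap (A pb) P)%E].
Proof.
exists (13824%:R^-1) => [|delta delta_ge0 /eqoP delta_o]; first by rewrite invr_gt0.
have e96 : 0 < 96^-1 :> R by [].
have [N _ HN] := delta_o _ e96.
exists N => n Nn n0 dx dy L M D eps d0 L0 M0 D0 eps0 A HA.
have nR : 0 < n%:R :> R by rewrite ltr0n.
have ndelta : n%:R * delta n <= 96^-1.
  have := HN n Nn; rewrite /= !ger0_norm ?invr_ge0// => h.
  by rewrite -ler_pdivlMl// mulrC.
have s0 : 0 < Num.sqrt (dx + dy)%:R :> R by rewrite sqrtr_gt0 ltr0n.
have sn0 : 0 < Num.sqrt n%:R :> R by rewrite sqrtr_gt0.
have sn1 : 1 <= Num.sqrt n%:R :> R by rewrite -[leLHS]sqrtr1 ler_sqrt// ler1n.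
pose kappa := M / Num.sqrt (dx + dy)%:R; pose r := D / 4.
have r0 : 0 < r by rewrite divr_gt0.
have k0 : 0 < kappa by rewrite divr_gt0.
pose pb : sp_problem R dx dy := linear_problem kappa r.
have pbC : sp_class L M D pb.
  by apply: linear_problem_class => //; rewrite ?ltW// /kappa mulfVK// gt_eqF.
have [Af Ap] := HA pb pbC.
pose m1 := (Num.sqrt n%:R)^-1 : R.
pose m2 := Num.min 1 (Num.sqrt (dx + dy)%:R / (eps * n%:R)).
pose mA := mean_output (seed_law (A pb)) (output (A := A pb)).
(* The instance found for tau has gap at least M D tau / 24 = 576 M D tau / 13824. *)
have main tau : 0 < tau -> tau <= 2^-1 -> m1 + m2 <= 576 * tau ->
   (forall q : 'I_(dx + dy) -> R, (forall j, `|q j| <= tau) ->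
    - (r * tau * Num.sqrt (dx + dy)%:R / 6) <=
    \sum_S data_law q S * \sum_i \sum_j mA S j * score tau q (tnth S i) j) ->
  exists P : probability (Zt pb) R,
    ((13824%:R^-1 * (M * D * (m1 + m2)))%:E <= weak_gap (A pb) P)%E.
  move=> tau0 tau2 m12 U.
  have mA_le S j : `|mA S j| <= r.
    apply: mean_output_le.
      by move=> S' j'; exact: measurable_output.
    by move=> w S' j'; apply: output_le => //; exact: ltW.
  have [q qt Hq] := linear_gap_lower_bound d0 r0 tau0 tau2 mA_le U.
  have q1 j : `|q j| <= 1 by apply: le_trans (qt j) _; lra.
  pose P := finite_probability (fun z => sign_law_ge0 z q1) (sum_sign_law q).
  exists P; apply: le_trans (weak_gap_ge Af (ltW r0) d0 tau0 qt (finite_probability1 _ _)).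
  rewrite lee_fin; apply: (@le_trans _ _ (kappa * (r * tau * Num.sqrt (dx + dy)%:R / 6))).
    rewrite (_ : kappa * _ = 13824%:R^-1 * (M * D * (576 * tau))).
      by rewrite ler_pM2l ?invr_gt0// ler_pM2l// mulr_gt0.
    by rewrite /kappa /r; field; rewrite gt_eqF.
  by rewrite ler_pM2l.
suff [P HP] : exists P : probability (Zt pb) R,
    ((13824%:R^-1 * (M * D * (m1 + m2)))%:E <= weak_gap (A pb) P)%E.
  exists pb, P; split => //; first exact: linear_problem_distribution.
  by apply: linear_problem_diameter => //; exact: ltW.
have m1pos : 0 < m1 by rewrite invr_gt0.
have [m21|m12] := leP m2 m1.
  (* The largest tau allowed by the sampling bound. *)
  apply: (main (m1 / 144)).
  - by rewrite divr_gt0// invr_gt0.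
  - have : m1 <= 1 by rewrite invf_le1.
    by lra.
  - by lra.
  move=> q qt; apply: sampling_bound => //.
  - by rewrite divr_gt0// invr_gt0.
  - have : m1 <= 1 by rewrite invf_le1.
    by lra.
  - move=> S; apply: mean_output_sqr.
    + by move=> S' j'; exact: measurable_output.
    + by move=> w S' j'; apply: output_le => //; exact: ltW.
    + by move=> w S'; apply: output_sqr => //; exact: ltW.
  - by rewrite /m1 mulrAC mulVf ?mul1r// gt_eqF.
have m20 : 0 < m2 by rewrite lt_min ltr01/= divr_gt0// mulr_gt0.
have m2le : m2 <= 1 by rewrite ge_min lexx.
(* The largest tau allowed by the privacy bound. *)
apply: (main (m2 / 288)).
- by rewrite divr_gt0.
- by lra.
- by lra.
move=> q qt; apply: (privacy_bound (eps := eps) (delta := delta n)) => //.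
- by rewrite divr_gt0.
- by lra.
- by move=> S' j'; exact: measurable_output.
- by move=> w S' j'; apply: output_le => //; exact: ltW.
- by move=> w S'; apply: output_sqr => //; exact: ltW.
- exact: output_private.
- rewrite -mulrA mulfVK//.
  have : m2 <= Num.sqrt (dx + dy)%:R / (eps * n%:R) by rewrite ge_min lexx orbT.
  by rewrite ler_pdivlMr ?mulr_gt0// mulrC [eps * _]mulrC.
Qed.
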